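(* Let $\mathbb F_q$ be a finite field with $q$ elements and $\mathcal X$ a finite non-empty totally ordered set of free non-commuting variables. Define polynomials $E_T(q)\in\mathbb Z[q]$, indexed by finite full subtrees $T\in\mathcal{FFT}(\mathcal X)$, recursively by $$E_T(q)=q^{\sharp V^\circ(T)}\prod_{\mathbf L\in\partial V(T)}q^{\sharp\{\mathbf X\in V^\circ(T)\,:\,\mathbf X<\mathbf L\}}-C_T(q),$$ $$C_T(q)=\sum_{T'\in\mathcal{FFT}(\mathcal X),\ T'<T}E_{T'}(q)\prod_{\mathbf L\in\partial V(T)}q^{\sharp\{\mathbf X\in V^\circ(T)\setminus V^\circ(T')\,:\,\mathbf X<\mathbf L\}},$$ and set $E_n(q)=\sum_{T\in\mathcal{FFT}(\mathcal X),\ \sharp V^\circ(T)=n}E_T(q)$ for $n\ge0$. Then: (i) For every $n\ge0$, the number of rational series of complexity $n$ in $\mathbb F_q\langle\!\langle\mathcal X\rangle\!\rangle_{rat}$ is $E_n(q)$. (ii) One has $$\sum_{A\in\mathbb F_q\langle\!\langle\mathcal X\rangle\!\rangle_{rat}}t^{\dim(\overline A)}=\sum_{n=0}^\infty E_n(q)t^n.$$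
   Context: Series. $\mathcal X^*$ is the free monoid on $\mathcal X$, with empty word $\emptyset$. For a field $\mathbb K$, $\mathbb K\langle\!\langle\mathcal X\rangle\!\rangle$ is the algebra of non-commutative formal power series $A=\sum_{\mathbf X\in\mathcal X^*}(A,\mathbf X)\mathbf X$ with the convolution product. A series is invertible iff its constant coefficient is non-zero. $\mathbb K\langle\!\langle\mathcal X\rangle\!\rangle_{rat}$ is the smallest subalgebra containing $\mathcal X$ and closed under inversion of those of its elements that are invertible in $\mathbb K\langle\!\langle\mathcal X\rangle\!\rangle$. For $\mathbf T\in\mathcal X^*$ put $\rho(\mathbf T)A=\sum_{\mathbf X}(A,\mathbf X\mathbf T)\mathbf X$, and let $\overline A$ be the linear span of all $\rho(\mathbf T)A$ (finite-dimensional iff $A$ is rational). The complexity of $A$ is $\dim(\overline A)$. Trees. With $k=\sharp\mathcal X$, $\mathcal X^*$ is viewed as the vertex set of the infinite $k$-regular tree rooted at $\emptyset$; the $k$ children of a vertex $\mathbf X$ are the words $X\mathbf X$ with $X\in\mathcal X$. A subtree $T$ (containing the root $\emptyset$) is full if each vertex of $T$ is either a leaf of $T$ (none of its children belong to $T$) or an interior vertex (all of its $k$ children belong to $T$). $\partial V(T)$ and $V^\circ(T)$ are the sets of leaves and interior vertices. $\mathcal{FFT}(\mathcal X)$ is the set of all finite full subtrees, including the tree reduced to the root, whose only vertex $\emptyset$ is a leaf. For trees, $T'<T$ means that $V^\circ(T')$ is a strict subset of $V^\circ(T)$. Order. The total order of $\mathcal X$ is extended to $\mathcal X^*$ right-to-left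 lexicographically: $\mathbf Z<\mathbf XX\mathbf Z<\mathbf YY\mathbf Z$ for all $\mathbf X,\mathbf Y,\mathbf Z\in\mathcal X^*$ and all $X<Y$ in $\mathcal X$ (words are compared letter by letter starting from the right, a proper suffix being smaller). *)

(* Defs.v *)
From HB Require Import structures.
From mathcomp Require Import all_boot all_order all_algebra finmap.
From mathcomp Require Import mathcomp_extra boolp classical_sets functions.
From mathcomp Require Import cardinality fsbigop.

Set Implicit Arguments.
Unset Strict Implicit.
Unset Printing Implicit Defensive.

Import Order.TTheory GRing.Theory Num.Theory.

Local Open Scope classical_set_scope.
Local Open Scope ring_scope.

(* K<<X>>: a series is its coefficient function on words.  The type is kept
   distinct from the function type [seq X -> K], whose library ring structure
   is the pointwise one. *)
Definition ncseries (X : eqType) (K : Type) : Type := seq X -> K.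

HB.instance Definition _ (X : eqType) (K : comNzRingType) :=
  GRing.Lmodule.copy (ncseries X K) (seq X -> K^o).

Section Ring.
Variables (X : eqType) (K : comNzRingType).
Implicit Types (A B C : ncseries X K) (w : seq X) (a : K).

Definition ncone : ncseries X K := fun w => (nilp w)%:R.

Definition ncmul A B : ncseries X K :=
  fun w => \sum_(i < (size w).+1) A (take i w) * B (drop i w).

Definition ncvar (x : X) : ncseries X K := fun w => (w == [:: x])%:R.

Lemma ncaddE A B w : (A + B) w = A w + B w. Proof. by []. Qed.

Lemma ncscaleE a A w : (a *: A) w = a * A w. Proof. by []. Qed.

Let ncshift (x : X) A : ncseries X K := fun w => A (x :: w).

Lemma ncmul_nil A B : ncmul A B [::] = A [::] * B [::].
Proof. by rewrite /ncmul big_ord_recl big_ord0 addr0. Qed.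

Lemma ncmul_cons A B x w :
  ncmul A B (x :: w) = A [::] * B (x :: w) + ncmul (ncshift x A) B w.
Proof. by rewrite /ncmul big_ord_recl. Qed.

Let ncmulDl : left_distributive ncmul +%R.
Proof.
move=> A B C; apply/funext => w; rewrite ncaddE /ncmul -big_split /=.
by apply: eq_bigr => i _; rewrite ncaddE mulrDl.
Qed.

Let ncmulDr : right_distributive ncmul +%R.
Proof.
move=> A B C; apply/funext => w; rewrite ncaddE /ncmul -big_split /=.
by apply: eq_bigr => i _; rewrite ncaddE mulrDr.
Qed.

Let ncmulZl a A B : a *: ncmul A B = ncmul (a *: A) B.
Proof.
apply/funext => w; rewrite ncscaleE /ncmul mulr_sumr.
by apply: eq_bigr => i _; rewrite ncscaleE mulrA.
Qed.

Let ncmulZr a A B : a *: ncmul A B = ncmul A (a *: B).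
Proof.
apply/funext => w; rewrite ncscaleE /ncmul mulr_sumr.
by apply: eq_bigr => i _; rewrite ncscaleE mulrCA.
Qed.

Let ncmulA : associative ncmul.
Proof.
move=> A B C; apply/funext => w.
elim: w A => [|x w IHw] A; first by rewrite !ncmul_nil mulrA.
have -> : ncmul (ncmul A B) C (x :: w) = ncmul A B [::] * C (x :: w)
    + ncmul (A [::] *: ncshift x B + ncmul (ncshift x A) B) C w.
  rewrite ncmul_cons; congr (_ + ncmul _ C w).
  by apply/funext => v; rewrite /ncshift ncmul_cons.
rewrite ncmul_cons IHw ncmul_cons ncmulDl ncaddE -ncmulZl ncscaleE.
by rewrite ncmul_nil mulrDr mulrA addrA.
Qed.

Let ncmul1 : left_id ncone ncmul.
Proof.
move=> A; apply/funext => -[|x w]; first by rewrite ncmul_nil mul1r.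
by rewrite ncmul_cons mul1r /ncmul big1 ?addr0 // => i _; rewrite mul0r.
Qed.

Let ncmulr1 : right_id ncone ncmul.
Proof.
move=> A; apply/funext => w.
elim: w A => [|x w IHw] A; first by rewrite ncmul_nil mulr1.
by rewrite ncmul_cons IHw mulr0 add0r.
Qed.

Let ncone_neq0 : ncone != 0.
Proof.
apply/eqP => /(congr1 (fun A : ncseries X K => A [::])).
by apply/eqP; exact: oner_neq0.
Qed.

HB.instance Definition _ := GRing.Zmodule_isNzRing.Build (ncseries X K)
  ncmulA ncmul1 ncmulr1 ncmulDl ncmulDr ncone_neq0.
HB.instance Definition _ :=
  GRing.Lmodule_isLalgebra.Build K (ncseries X K) ncmulZl.
HB.instance Definition _ :=
  GRing.Lalgebra_isAlgebra.Build K (ncseries X K) ncmulZr.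

Lemma ncmulE A B w :
  (A * B) w = \sum_(i < (size w).+1) A (take i w) * B (drop i w).
Proof. by []. Qed.

Definition rational_series : set (ncseries X K) :=
  smallest [set S : set (ncseries X K) |
      GRing.subalg_closed [in S] /\
      forall A B, A \in S -> A * B = 1 -> B * A = 1 -> B \in S]
    (range ncvar).

End Ring.

(* The library's subspaces live in finite-dimensional spaces, while K<<X>> is
   infinite-dimensional. *)
Section Dimension.
Variables (K : fieldType) (V : lmodType K).

Definition lspan (G : set V) : set V :=
  smallest [set S : set V | GRing.submod_closed [in S]] G.

Definition has_dim (S : set V) (n : nat) : Prop :=
  exists b : 'I_n -> V,
    (forall c : 'I_n -> K, \sum_i c i *: b i = 0 -> forall i, c i = 0) /\
    lspan (range b) = S.

(* 0 if S is infinite-dimensional *)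
Definition ldim (S : set V) : nat := xget 0%N [set n | has_dim S n].

End Dimension.

Section Complexity.
Variables (X : eqType) (K : fieldType).

Definition rho (T : seq X) (A : ncseries X K) : ncseries X K :=
  fun w => A (w ++ T).

Definition rclosure (A : ncseries X K) : set (ncseries X K) :=
  lspan (range (rho^~ A)).

End Complexity.

(* A family is summable if each coefficient is a finite sum; [\sum_(i \in D)]
   is the sum over the support of the summand, when that support is finite. *)
Section Summation.
Variables (X : eqType) (K : comNzRingType) (I : choiceType).

Definition ncsummable (D : set I) (f : I -> ncseries X K) : Prop :=
  forall w, finite_set [set i | D i /\ f i w != 0].

Definition ncsum (D : set I) (f : I -> ncseries X K) : ncseries X K :=
  fun w => \sum_(i \in D) f i w.

End Summation.

(* Z[[t]] is the case of the one-letter alphabet {t} = unit. *)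
Notation fps := (ncseries unit int).

Definition fps_t : fps := @ncvar unit int tt.

Local Open Scope fset_scope.

Section Trees.
Variables (d : Order.disp_t) (X : finOrderType d).
Implicit Types (V : {fset seq X}) (v w : seq X).

Definition word_lt v w : bool :=
  (rev v < rev w :> Order.SeqLexiOrder.type_ X)%O.

Lemma word_lt_suffix v w : w != [::] -> word_lt v (w ++ v).
Proof.
rewrite /word_lt rev_cat -size_eq0 -size_rev size_eq0.
elim: (rev v) => [|x s IHs] w0; rewrite ?ltxi0s //.
by rewrite Order.SeqLexiOrder.eqhead_ltxiE IHs.
Qed.

Lemma word_lt_letter u v w (x y : X) : (x < y)%O ->
  word_lt (u ++ x :: w) (v ++ y :: w).
Proof.
move=> xy; rewrite /word_lt !rev_cat !rev_cons !cat_rcons.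
elim: (rev w) => [|z s IHs].
  by rewrite Order.SeqLexiOrder.neqhead_ltxiE ?(lt_eqF xy).
by rewrite Order.SeqLexiOrder.eqhead_ltxiE IHs.
Qed.

Definition leaves V : {fset seq X} :=
  [fset v in V | [forall x : X, x :: v \notin V]].

Definition inner V : {fset seq X} :=
  [fset v in V | [forall x : X, x :: v \in V]].

(* the parent of a non-empty word [v] is [behead v] *)
Definition is_full_subtree V : bool :=
  [&& [::] \in V, [forall v : V, behead (val v) \in V]
    & [forall v : V, (val v \in leaves V) || (val v \in inner V)]].

Record fftree := FFTree {
  vertices :> {fset seq X};
  _ : is_full_subtree vertices
}.

HB.instance Definition _ := [isSub for vertices].
HB.instance Definition _ := [Choice of fftree by <:].

Implicit Types T : fftree.

Definition tree_lt (T' T : fftree) : bool := inner T' `<` inner T.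

Definition nbelow V w : nat := #|` [fset v in V | word_lt v w] |.

Definition tree_corr (E : fftree -> {poly int}) T : {poly int} :=
  \sum_(T' \in [set T' : fftree | tree_lt T' T])
     E T' * \prod_(L <- leaves T) 'X^(nbelow (inner T `\` inner T') L).

(* Recursion on a strict upper bound [m] of the number of interior vertices;
   the recursive formula for E_T is [tree_polyE] below. *)
Fixpoint tree_poly_rec (m : nat) T : {poly int} :=
  if m is m'.+1 then
    'X^(#|` inner T|) * \prod_(L <- leaves T) 'X^(nbelow (inner T) L)
      - tree_corr (tree_poly_rec m') T
  else 0.

Definition tree_poly T : {poly int} := tree_poly_rec (#|` inner T|).+1 T.

Lemma tree_polyE T :
  tree_poly T =
    'X^(#|` inner T|) * \prod_(L <- leaves T) 'X^(nbelow (inner T) L)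
      - tree_corr tree_poly T.
Proof.
have fuel m p T' : (#|` inner T'| < m)%N -> (#|` inner T'| < p)%N ->
    tree_poly_rec m T' = tree_poly_rec p T'.
  elim: m p T' => // m IHm [//|p] T' lem lep /=.
  congr (_ - _); apply: eq_fsbigr => T0.
  rewrite inE /= => /fproper_ltn_card lt0.
  by rewrite (IHm p) // (leq_trans lt0).
rewrite {1}/tree_poly /=; congr (_ - _); apply: eq_fsbigr => T'.
by rewrite inE /= => /fproper_ltn_card lt;
   rewrite /tree_poly (fuel _ (#|` inner T'|).+1).
Qed.

Lemma mem_fftree T v : v \in (T : {fset _}) -> v = [::] \/ behead v \in inner T.
Proof.
case: T => V /= /and3P[_ /forallP parent /forallP full] vV.
case: v vV => [|x v] vV; [by left | right => /=].
have vV' : v \in V by have := parent [` vV].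
have /orP[|//] := full [` vV'].
by rewrite !inE /= => /andP[_ /forallP/(_ x)]; rewrite vV.
Qed.

Lemma fftree_nil T : [::] \in (T : {fset _}).
Proof. by case: T => V /= /and3P[]. Qed.

Lemma inner_child T v (x : X) : v \in inner T -> x :: v \in (T : {fset _}).
Proof. by rewrite !inE => /andP[_ /forallP]. Qed.

Lemma finite_fftree_sub V : finite_set [set T : fftree | (T : {fset _}) `<=` V].
Proof.
have -> : [set T : fftree | (T : {fset _}) `<=` V]%fset =
    vertices @^-1` [set` fpowerset V].
  by apply/seteqP; split=> T /=; rewrite fpowersetE.
apply: finite_preimage; last exact: finite_fset.
by move=> T T' _ _ /val_inj.
Qed.

Lemma finite_tree_lt T : finite_set [set T' : fftree | tree_lt T' T].
Proof.
apply: sub_finite_set (finite_fftree_sub T) => T' /= /fproper_sub/fsubsetP sub.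
apply/fsubsetP => v /mem_fftree[->|/sub]; first exact: fftree_nil.
case: v => [|x v] /=; last exact: inner_child.
by rewrite fftree_nil.
Qed.

Lemma size_fftree T v : v \in (T : {fset _}) -> (size v <= #|` inner T|)%N.
Proof.
have drop_inner w i : w \in (T : {fset _}) -> (i < size w)%N ->
    drop i.+1 w \in inner T.
  elim: i w => [|i IHi] [//|x w] /mem_fftree[//|/= wI] lti.
    by rewrite drop0.
  by apply: IHi => //; move: wI; rewrite !inE => /andP[].
move=> vT; pose S := [fset drop (val i).+1 v | i : 'I_(size v)].
have <- : #|` S| = size v.
  rewrite card_imfset /= ?size_enum_ord // => i j /(congr1 size) /eqP.
  rewrite !size_drop => /eqP eq_ij; apply: val_inj => /=.
  have := ltn_ord i; have := ltn_ord j; move: eq_ij.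
  by move=> eq_ij ltj lti; apply/succn_inj; rewrite -(subKn lti) eq_ij subKn.
apply: fsubset_leq_card; apply/fsubsetP => w /imfsetP[i _ ->].
exact: (drop_inner _ _ vT (ltn_ord i)).
Qed.

Lemma finite_fftree_card n : finite_set [set T : fftree | #|` inner T| = n].
Proof.
pose V : {fset seq X} := [fset w in flatten
  [seq [seq val t | t <- enum {: k.-tuple X}] | k <- iota 0 n.+1]].
apply: (@sub_finite_set _ _ _ _ (finite_fftree_sub V)) => T /= eT.
apply/fsubsetP => v /size_fftree; rewrite eT => lev.
apply/imfsetP; exists v => //.
apply/flattenP; exists [seq val t | t <- enum {: (size v).-tuple X}].
  by apply/mapP; exists (size v); rewrite // mem_iota ltnS.
by apply/mapP; exists (in_tuple v); rewrite ?mem_enum.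
Qed.

Definition complexity_poly (n : nat) : {poly int} :=
  \sum_(T \in [set T : fftree | #|` inner T| = n]) tree_poly T.

End Trees.

(* Main.v *)
(* The polynomials annihilating a series A of complexity n form a left ideal of
   codimension n of K<X>, which is a free left module of rank r = 1 + n(k - 1).
   Up to change of basis, the reachable realizations of A of dimension N are the
   submodules of codimension N - n of this ideal, so that their number
   Q(N - n, r) depends only on N - n and r.  Since a reachable realization
   realizes exactly one series, the numbers a_n of series of complexity n satisfy
     sum_(n <= N) a_n Q(N - n, 1 + n(k - 1)) = q^N Q(N, 1).
   The number Q(m, r) is also the weighted number of forests with r roots and m
   interior vertices; grouping the trees T above each T' thus gives the same
   triangular system for E_n, and a_n = E_n.  The equality holds only after
   summing over all T with n interior vertices: no bijective meaning of the
   individual E_T is used.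
     Q is computed without ideals: count all realizations mapping onto the minimal
   one, reachable or not, according to the dimension of their reachable space;
   sum_forest_count is the resulting identity. *)
Require Import Defs.
From mathcomp Require Import all_boot all_order all_algebra finmap.
From mathcomp Require Import mathcomp_extra boolp classical_sets functions.
From mathcomp Require Import cardinality fsbigop.
From mathcomp Require Import zify ring.

Set Implicit Arguments.
Unset Strict Implicit.
Unset Printing Implicit Defensive.

Import Order.TTheory GRing.Theory Num.Theory.

Local Open Scope ring_scope.

(** * The numbers Q(m, r) *)

Section ForestCount.
Variables (q : int) (c : nat).

(* The weighted number of forests with r ordered roots, m interior vertices and
   arity c.+1: either the first root is a leaf, or it is interior and each of
   the r + m * c leaves of the forest, being larger, gains a factor q. *)
Fixpoint forest_count (m : nat) : nat -> int :=
  if m is m'.+1 then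
    fix count (r : nat) : int :=
      if r is r'.+1 then
        count r' + q ^+ (r + m * c) * forest_count m' (r' + c.+1)
      else 0
  else fun=> 1.

(** Over a field with q elements, this is the number of free j-tuples in a space of dimension m
    ([card_row_free]); for j = m it is the order of GL_m. *)
Definition free_count (j m : nat) : int := \prod_(i < j) (q ^+ m - q ^+ i).

Lemma forest_countS m r :
  forest_count m.+1 r.+1 =
    forest_count m.+1 r
      + q ^+ (r.+1 + m.+1 * c) * forest_count m (r + c.+1).
Proof. by []. Qed.

Lemma free_count0 m : free_count 0 m = 1.
Proof. by rewrite /free_count big_ord0. Qed.

Lemma free_countSS j m :
  free_count j.+1 m.+1 = (q ^+ m.+1 - 1) * (q ^+ j * free_count j m).
Proof.
rewrite /free_count big_ord_recl expr0; congr (_ * _).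
under eq_bigr => i _ do rewrite exprS [X in _ - X]exprS -mulrBr.
by rewrite big_split prodr_const card_ord.
Qed.

Lemma free_count_eq0 j m : (m < j)%N -> free_count j m = 0.
Proof.
by move=> mj; rewrite /free_count (bigD1 (Ordinal mj)) //= subrr mul0r.
Qed.

Lemma free_countD n j m :
  free_count (n + j) (n + m) =
    free_count n (n + m) * (q ^+ (n * j) * free_count j m).
Proof.
rewrite /free_count big_split_ord; congr (_ * _).
under eq_bigr => i _ do rewrite exprD [X in _ - X]exprD -mulrBr.
by rewrite big_split prodr_const card_ord exprM.
Qed.

Lemma free_count_neq0 m : 1 < q -> free_count m m != 0.
Proof.
move=> q1; apply/prodf_neq0 => i _.
by rewrite subr_eq0 gt_eqF // ltr_eXn2l.
Qed.

(** For q a prime power, both sides count the families of c.+1 endomorphisms and s vectors of a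
    space of dimension m, on the left by the dimension j of the stable subspace generated by the
    vectors. The proof works for every integer q, by induction on m and then on s. *)
Lemma sum_forest_count m s :
  \sum_(j < m.+1) free_count j m * q ^+ ((m - j) * (m * c.+1)) *
     forest_count j s
  = q ^+ (m * (m * c.+1 + s)).
Proof.
elim: m s => [|m IHm] s.
  by rewrite big_ord_recl big_ord0 free_count0 mul0n !expr0 /= addr0 !mulr1.
elim: s => [|s IHs].
  rewrite big_ord_recl free_count0 big1; last by move=> i _ /=; rewrite mulr0.
  by rewrite subn0 addn0 mul1r mulr1 addr0.
rewrite big_ord_recl.
under eq_bigr => i _ do rewrite lift0 forest_countS mulrDr.
rewrite big_split addrA.
rewrite big_ord_recl in IHs.
rewrite [X in X + _](_ : _ = q ^+ (m.+1 * (m.+1 * c.+1 + s))) //.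
(* The first part is the identity for s. In the second, [free_countSS] turns each term into a common
   factor times a term of the identity for m and s + c.+1. *)
transitivity (q ^+ (m.+1 * (m.+1 * c.+1 + s)) + (q ^+ m.+1 - 1) *
   q ^+ (m.+1 * c.+1 + s) *
   \sum_(i < m.+1) free_count i m * q ^+ ((m - i) * (m * c.+1))
      * forest_count i (s + c.+1)).
  congr (_ + _); rewrite mulr_sumr; apply: eq_bigr => -[i lti] _ /=.
  rewrite free_countSS subSS.
  have -> : q ^+ ((m - i) * (m.+1 * c.+1)) =
            q ^+ ((m - i) * (m * c.+1)) * q ^+ ((m - i) * c.+1).
    by rewrite -exprD; congr (_ ^+ _); lia.
  have E : q ^+ (m.+1 * c.+1 + s) =
           q ^+ ((m - i) * c.+1) * q ^+ i * q ^+ (s.+1 + i.+1 * c).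
    by rewrite -!exprD; congr (_ ^+ _); nia.
  by rewrite E; ring.
rewrite IHm.
have -> : q ^+ (m.+1 * (m.+1 * c.+1 + s.+1)) =
   q ^+ m.+1 * q ^+ (m.+1 * (m.+1 * c.+1 + s)).
  by rewrite -exprD; congr (_ ^+ _); nia.
rewrite -mulrA -exprD.
have -> : (m.+1 * c.+1 + s + m * (m * c.+1 + (s + c.+1)) =
          m.+1 * (m.+1 * c.+1 + s))%N by nia.
ring.
Qed.

(** The number, up to change of basis, of reachable lifts of dimension p of a reachable realization
    of dimension n ([card_reachable_lifts]). It vanishes for p < n because the linear map of a lift
    is surjective. *)
Definition lift_count (n p : nat) : int :=
  if (n <= p)%N then forest_count (p - n) (1 + n * c) else 0.

(** This is [sum_forest_count] for N - n and 1 + n * c, multiplied by a common factor. The right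
    side is the number of all lifts of dimension N, and the terms on the left will sort them by the
    rank p of their reachable space. *)
Lemma sum_lift_count n N : (n <= N)%N ->
  \sum_(p < N.+1) free_count p N * lift_count n p *
     q ^+ ((N - p) * (n + (N - n) * c.+1))
  = free_count n N * q ^+ ((N - n) * (N * c.+1 + 1)).
Proof.
move=> /subnKC <-; set m := (N - n)%N; rewrite addKn -addnS big_split_ord /=.
rewrite big1 ?add0r => [|i _]; last first.
  by rewrite /lift_count leqNgt ltn_ord mulr0 mul0r.
have -> : (m * ((n + m) * c.+1 + 1) = n * m + m * (m * c.+1 + (1 + n * c)))%N.
  by nia.
rewrite exprD -sum_forest_count !mulr_sumr; apply: eq_bigr => -[j ltj] _ /=.
rewrite /lift_count leq_addr addKn subnDl free_countD.
have E : q ^+ (n * j) * q ^+ ((m - j) * (n + m * c.+1)) =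
    q ^+ (n * m) * q ^+ ((m - j) * (m * c.+1)).
  by rewrite -!exprD; congr (_ ^+ _); nia.
move: (q ^+ (n * j)) (q ^+ ((m - j) * (n + m * c.+1))) E => u v E.
transitivity (free_count n (n + m) * free_count j m *
  forest_count j (1 + n * c) * (u * v)); [ring | rewrite E; ring].
Qed.

End ForestCount.

(** * Counting lifts of a reachable realization *)

Lemma card_uniform_fibers (aT rT : finType) (f : aT -> rT) (A : {set aT}) m :
    (forall y, y \in f @: A -> #|[set x in A | f x == y]| = m) ->
  #|A| = (m * #|f @: A|)%N.
Proof.
move=> card_fib; rewrite -sum1_card (partition_big f (mem (f @: A))) /=.
  rewrite mulnC -sum_nat_const; apply: eq_bigr => y yA.
  by rewrite -(card_fib y yA) -sum1_card; apply: eq_bigl => x; rewrite inE.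
by move=> x xA; apply: imset_f.
Qed.

(** * Counting matrices over a finite field *)

Section MatrixCount.
Variable F : finFieldType.
Local Notation q := (#|F|%:Z).

Lemma card_field_gt0 : (0 < #|F|)%N.
Proof. exact: ltnW (card_finNzRing_gt1 F). Qed.

(** A non-empty fibre of f on the subgroup P is a translate of the kernel. *)
Lemma card_linear_fiber a b (V : finZmodType) (f : {additive 'M[F]_(a, b) -> V})
    (P : {pred 'M[F]_(a, b)}) C0 :
  zmod_closed P -> C0 \in P ->
  #|[set M in P | f M == f C0]| = #|[set M in P | f M == 0]|.
Proof.
move=> clP C0P; have clN := GRing.zmod_closedN clP.
have clD := (GRing.zmod_closedD clP).2.
rewrite -[RHS](card_imset _ (addIr C0)); apply: eq_card => M.
apply/idP/imsetP => [|[M' + ->]]; rewrite !inE.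
  case/andP=> MP /eqP fM; exists (M - C0); last by rewrite subrK.
  by rewrite inE clP.2 //= raddfB fM subrr eqxx.
by case/andP=> MP /eqP fM; rewrite clD //= raddfD fM add0r.
Qed.

Lemma card_linear_image a b (V : finZmodType)
    (f : {additive 'M[F]_(a, b) -> V}) (P : {pred 'M[F]_(a, b)}) :
  zmod_closed P ->
  #|[set M in P]| = (#|[set M in P | f M == 0%R]| * #|f @: [set M in P]|)%N.
Proof.
move=> clP; apply: card_uniform_fibers => _ /imsetP[C0 + ->].
rewrite inE => C0P; rewrite -(card_linear_fiber f clP C0P).
by apply: eq_card => M; rewrite !inE.
Qed.

Lemma card_mulmxr_fiber a N n (p : 'M[F]_(N, n)) (C : 'M[F]_(a, n)) :
  row_full p -> #|[set M : 'M_(a, N) | M *m p == C]| = (#|F| ^ (a * (N - n)))%N.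
Proof.
move=> pF; have nN : (n <= N)%N by rewrite -(eqnP pF) rank_leq_row.
have clT : zmod_closed (predT : {pred 'M[F]_(a, N)}) by split.
have -> : [set M : 'M_(a, N) | M *m p == C]
    = [set M in predT | mulmxr p M == mulmxr p (C *m pinvmx p)].
  by apply/setP => M; rewrite !inE /= -mulmxA mulVpmx // mulmx1.
rewrite (card_linear_fiber _ clT) //.
have := card_linear_image (mulmxr p) clT.
have -> : mulmxr p @: [set M in predT] = [set: 'M_(a, n)].
  apply/setP => D; rewrite inE; apply/imsetP; exists (D *m pinvmx p).
    by rewrite inE.
  by rewrite /= -mulmxA mulVpmx // mulmx1.
have -> : [set M in (predT : {pred 'M[F]_(a, N)})] = [set: 'M_(a, N)].
  by apply/setP => M; rewrite !inE.
rewrite !cardsT !card_mx => E; apply/eqP.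
rewrite -(eqn_pmul2r (m := #|F| ^ (a * n))) ?expn_gt0 ?card_field_gt0 //.
by rewrite -E -expnD -mulnDr subnK.
Qed.

Lemma card_mulmxl_fiber p N b (A : 'M[F]_(p, N)) (C : 'M[F]_(p, b)) :
  row_free A -> #|[set M : 'M_(N, b) | A *m M == C]| = (#|F| ^ ((N - p) * b))%N.
Proof.
move=> fA; have AF : row_full A^T by rewrite /row_full mxrank_tr.
have := card_mulmxr_fiber C^T AF.
rewrite mulnC => <-; rewrite -[RHS](card_imset _ (@trmx_inj _ _ _)).
apply: eq_card => M; rewrite inE; apply/eqP/imsetP => [AM|[M' + ->]].
  by exists M^T; rewrite ?trmxK // inE -AM trmx_mul.
by rewrite inE => /eqP/(congr1 trmx); rewrite trmx_mul !trmxK.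
Qed.

(** M is prescribed on the row space of A and modulo the kernel of P, and C P = A D is the
    compatibility of the two prescriptions. The solutions form a translate of the kernel of M -> M P
    on the matrices with A M = 0, a map whose image consists of all matrices killed by A. *)
Lemma card_mulmx_fiber2 p N n (A : 'M[F]_(p, N)) (P : 'M[F]_(N, n))
    (C : 'M[F]_(p, N)) (D : 'M[F]_(N, n)) :
    row_free A -> row_full P -> C *m P = A *m D ->
  #|[set M : 'M_N | (A *m M == C) && (M *m P == D)]|
  = (#|F| ^ ((N - p) * (N - n)))%N.
Proof.
move=> fA fP eqCD; have nN : (n <= N)%N by rewrite -(eqnP fP) rank_leq_row.
have clK k : zmod_closed [pred M : 'M[F]_(N, k) | A *m M == 0].
  split=> [|M M']; rewrite !inE ?mulmx0 //.
  by rewrite mulmxBr => /eqP -> /eqP ->; rewrite subrr.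
have [A' AA'] := row_freeP fA; have [P' P'P] := row_fullP fP.
(* Since A A' = 1, the second summand is killed by A. Since P' P = 1, multiplication by P gives A' C
   P + D - A' A D, which is D by compatibility. *)
pose M0 := A' *m C + (1%:M - A' *m A) *m D *m P'.
have AM0 : A *m M0 = C.
  rewrite /M0 mulmxDr !mulmxA AA' mul1mx mulmxBr mulmx1 !mulmxA AA' mul1mx.
  by rewrite subrr !mul0mx addr0.
have M0P : M0 *m P = D.
  rewrite /M0 mulmxDl -!mulmxA P'P mulmx1 eqCD mulmxBl mul1mx -!mulmxA.
  by rewrite addrC subrK.
have -> : [set M : 'M_N | (A *m M == C) && (M *m P == D)] =
    [set M + M0 | M in [set M in [pred M : 'M[F]_N | A *m M == 0] | mulmxr P M == 0]].
  apply/setP => M; apply/idP/imsetP => [|[M' + ->]]; rewrite !inE.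
    case/andP => /eqP AM /eqP MP; exists (M - M0); last by rewrite subrK.
    by rewrite !inE /= mulmxBr mulmxBl AM AM0 MP M0P !subrr !eqxx.
  rewrite /= => /andP[/eqP AM /eqP MP].
  by rewrite mulmxDr mulmxDl AM MP !add0r AM0 M0P !eqxx.
rewrite (card_imset _ (addIr M0)).
have := card_linear_image (mulmxr P) (clK N).
have -> : mulmxr P @: [set M in [pred M : 'M[F]_N | A *m M == 0]]
    = [set M : 'M_(N, n) | A *m M == 0].
  apply/setP => M; rewrite inE; apply/imsetP/eqP => [[M' + ->]|AM].
    by rewrite !inE /= mulmxA => /eqP ->; rewrite mul0mx.
  exists (M *m P'); first by rewrite !inE mulmxA AM mul0mx.
  by rewrite /= -mulmxA P'P mulmx1.
have -> : [set M in [pred M : 'M[F]_N | A *m M == 0]] = [set M : 'M_N | A *m M == 0].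
  by apply/setP => M; rewrite !inE.
rewrite !card_mulmxl_fiber // => E; apply/eqP.
rewrite -(eqn_pmul2r (m := #|F| ^ ((N - p) * n))) ?expn_gt0 ?card_field_gt0 //.
by rewrite -E -expnD -mulnDr subnK.
Qed.

Lemma row_free_col_mx p N (u : 'rV[F]_N) (M : 'M[F]_(p, N)) :
  row_free (col_mx u M) = row_free M && ~~ (u <= M)%MS.
Proof.
rewrite -!row_leq_rank -addsmxE; apply/idP/andP => [pr|[pM uM]].
  have := leq_trans pr (mxrank_adds_leqif u M).1; have := rank_leq_row u.
  move=> ru rM; split; first by lia.
  apply/negP => /addsmx_idPr uM; move: pr; rewrite uM.
  by have := rank_leq_row M; lia.
have : (M < u + M)%MS.
  by rewrite ltmxE addsmxSr addsmx_sub negb_and uM.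
by move/rank_ltmx; lia.
Qed.

Lemma card_row_span p N (M : 'M[F]_(p, N)) : row_free M ->
  #|[set u : 'rV[F]_N | (u <= M)%MS]| = (#|F| ^ p)%N.
Proof.
move=> fM; rewrite -[p in RHS]mul1n -(card_mx F 1 p) -cardsT.
rewrite -(card_imset _ (can_inj (mulmxKp fM))); apply: eq_card => u.
rewrite inE; apply/submxP/imsetP => [[D ->]|[D _ ->]]; last by exists D.
by exists D; rewrite ?inE.
Qed.

(** A free family of p rows is extended by any of the q^N - q^p vectors outside its span; here the
    new row is put on top. *)
Lemma card_row_free p N : #|[set M : 'M[F]_(p, N) | row_free M]|%:Z = free_count q p N.
Proof.
elim: p => [|p IHp].
  rewrite free_count0 (_ : [set _ | _] = [set: 'M_(0, N)]).
    by rewrite cardsT card_mx mul0n.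
  by apply/setP => M; rewrite !inE -row_leq_rank.
rewrite /free_count big_ord_recr /= -[X in X * _]/(free_count q p N) -IHp.
rewrite -[in LHS]sum1_card.
rewrite (partition_big (fun M : 'M[F]_(1 + p, N) => dsubmx M) (@row_free F p N)) /=;
  last first.
  move=> M; rewrite inE -[M in row_free M]vsubmxK row_free_col_mx.
  by case/andP.
rewrite -[in RHS]sum1_card -!natz !natr_sum mulr_suml.
under [RHS]eq_bigl => M do rewrite inE.
apply: eq_bigr => M fM; rewrite mul1r.
rewrite sum1_card -!natrX -(card_row_span fM).
have -> : (#|F| ^ N)%N = #|{: 'rV[F]_N}| by rewrite card_mx mul1n.
rewrite -(cardsC [set u : 'rV[F]_N | (u <= M)%MS]) natrD addrC addKr.
congr (_%:R); have inj_col : injective (fun u : 'rV[F]_N => col_mx u M).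
  by move=> u v /eq_col_mx[].
rewrite -(card_imset _ inj_col); apply: eq_card => M'.
apply/idP/imsetP => [|[u uM ->]].
  case/andP; rewrite inE => fM' /eqP eM.
  exists (usubmx M'); last by rewrite -eM vsubmxK.
  by move: fM'; rewrite -[M']vsubmxK row_free_col_mx eM col_mxKu !inE => /andP[].
by apply/andP; move: uM; rewrite !inE row_free_col_mx fM col_mxKd.
Qed.

(** The bases of W are the products of invertible matrices with one fixed basis. *)
Lemma card_row_basis p N (W : 'M[F]_N) : \rank W = p ->
  #|[set b : 'M[F]_(p, N) | row_free b && (b == W)%MS]|%:Z = free_count q p p.
Proof.
move=> rW; case: _ / rW; rewrite -card_row_free; congr (_%:Z).
have fb0 := row_base_free W.
rewrite -[RHS](card_imset _ (can_inj (mulmxKp fb0))); apply: eq_card => b.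
apply/idP/imsetP => [|[g + ->]]; rewrite !inE.
  case/andP=> fb /eqmxP bW; have bb0 : (b <= row_base W)%MS by rewrite bW eq_row_base.
  exists (b *m pinvmx (row_base W)); last by rewrite mulmxKpV.
  rewrite inE -row_leq_rank (leq_trans _ (mxrankM_maxl _ (row_base W))) //.
  by rewrite mulmxKpV // row_leq_rank.
move=> fg; have gf : row_full g by rewrite row_full_unit -row_free_unit.
rewrite -row_leq_rank mxrankMfree // row_leq_rank fg /=.
by apply/eqmxP; apply: eqmx_trans (eqmxMfull _ gf) (eq_row_base _).
Qed.

End MatrixCount.

Lemma card_triples (A B C : finType) (P : pred C) (Q : C -> pred A) (R : C -> pred B) :
  #|[set t : A * B * C | [&& P t.2, Q t.2 t.1.1 & R t.2 t.1.2]]| =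
  (\sum_(z | P z) #|[set x | Q z x]| * #|[set y | R z y]|)%N.
Proof.
rewrite -sum1_card (partition_big snd P) /=; last first.
  by move=> t; rewrite inE => /and3P[].
apply: eq_bigr => z Pz; rewrite -cardsX sum1_card.
have inj_z : injective (fun s : A * B => (s, z)) by move=> s s' [].
rewrite -(card_imset _ inj_z); apply: eq_card => -[[x y] z'].
apply/andP/imsetP => [[]|[[x' y'] + [-> -> ->]]]; rewrite !inE /=.
  by case/and3P=> _ Qx Ry /eqP zz; exists (x, y); rewrite ?inE /= -zz ?Qx.
by case/andP=> Qx Ry; rewrite Pz Qx Ry.
Qed.

Lemma card_ffun_family (A B : finType) (P : A -> pred B) :
  #|[set f : {ffun A -> B} | [forall x, P x (f x)]]| = (\prod_x #|[set y | P x y]|)%N.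
Proof.
rewrite -(eq_card (A := family (fun x => [set y | P x y]))).
  by rewrite card_family foldrE big_map big_enum.
move=> f; rewrite inE; apply/familyP/forallP => fP x; have := fP x; by rewrite inE.
Qed.

(** * Reachable spaces and lifts of realizations *)

Section Reach.
Variables (X : finType) (F : finFieldType).

(** Words are read from their right end, in accordance with [rho]: replacing g by the state reached
    by T amounts to appending T on the right of w. *)
Definition state N (B : X -> 'M[F]_N) (g : 'rV[F]_N) (w : seq X) : 'rV[F]_N :=
  foldr (fun x v => v *m B x) g w.

(** The span of all states. There are infinitely many words but, F being finite, only finitely many
    states, so the sum runs over vectors. *)
Definition reachmx N (B : X -> 'M[F]_N) (g : 'rV[F]_N) : 'M[F]_N :=
  (\sum_(v : 'rV[F]_N | `[< exists w, v = state B g w >]) <<v>>)%MS.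

Section Fixed.
Variables (N : nat) (B : X -> 'M[F]_N) (g : 'rV[F]_N).

Lemma state_reach w : (state B g w <= reachmx B g)%MS.
Proof.
apply: (sumsmx_sup (state B g w)); last by rewrite genmxE.
by apply/asboolP; exists w.
Qed.

Lemma reachmx_sub m (U : 'M[F]_(m, N)) :
  (forall w, (state B g w <= U)%MS) -> (reachmx B g <= U)%MS.
Proof.
move=> sU; apply/sumsmx_subP => v /asboolP[w ->]; rewrite genmxE; exact: sU.
Qed.

Lemma reachmx_mul0 m (M : 'M[F]_(N, m)) :
  (forall w, state B g w *m M = 0) -> reachmx B g *m M = 0.
Proof.
move=> M0; apply/sub_kermxP/reachmx_sub => w; exact/sub_kermxP/M0.
Qed.

Lemma reachmx_stable x : (reachmx B g *m B x <= reachmx B g)%MS.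
Proof.
rewrite submxE -mulmxA; apply/eqP/reachmx_mul0 => w.
rewrite mulmxA; apply/eqP; rewrite -submxE; exact: (state_reach (x :: w)).
Qed.

End Fixed.

Lemma state_mul N n (B : X -> 'M[F]_N) g (B' : X -> 'M[F]_n) p w :
    (forall x, B x *m p = p *m B' x) ->
  state B g w *m p = state B' (g *m p) w.
Proof. by move=> Bp; elim: w => //= x w <-; rewrite -!mulmxA Bp. Qed.

Lemma reachmx_mul N n (B : X -> 'M[F]_N) g (B' : X -> 'M[F]_n) p :
    (forall x, B x *m p = p *m B' x) ->
  (reachmx B g *m p :=: reachmx B' (g *m p))%MS.
Proof.
move=> Bp; apply/eqmxP/andP; split.
  rewrite submxE -mulmxA; apply/eqP/reachmx_mul0 => w.
  apply/eqP; rewrite mulmxA -submxE (state_mul _ _ Bp); exact: state_reach.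
apply: reachmx_sub => w; rewrite -(state_mul _ _ Bp); exact/submxMr/state_reach.
Qed.

Definition reachable N (B : X -> 'M[F]_N) g := row_full (reachmx B g).

Section Lifts.
Variables (n : nat) (B' : {ffun X -> 'M[F]_n}) (g' : 'rV[F]_n).
Hypothesis reach' : reachable B' g'.

(** The third component is the linear map p onto the state space of the fixed realization. No output
    form is recorded: the lift inherits it by composition with p. *)
Definition lift_data N := ({ffun X -> 'M[F]_N} * 'rV[F]_N * 'M[F]_(N, n))%type.

Definition is_lift N (t : lift_data N) :=
  (t.1.2 *m t.2 == g') && [forall x, t.1.1 x *m t.2 == t.2 *m B' x].

Definition lifts N := [set t : lift_data N | is_lift t].

Definition rank_lifts N p :=
  [set t in lifts N | \rank (reachmx t.1.1 t.1.2) == p].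

(** The reachable space of the lift is mapped onto that of (B', g'), which is the whole space. *)
Lemma lift_full N (t : lift_data N) : is_lift t -> row_full t.2.
Proof.
case/andP=> /eqP gp /forallP Bp; rewrite -sub1mx.
apply: submx_trans (submxMl (reachmx t.1.1 t.1.2) t.2).
by rewrite (@reachmx_mul _ _ _ _ B') ?gp ?sub1mx // => x; apply/eqP.
Qed.

Local Notation q := (#|F|%:Z).

(** Once the surjective map p is chosen, the matrix of each letter and the vector g vary
    independently in fibres of right multiplication by p. *)
Lemma card_lifts N :
  #|lifts N|%:Z = free_count q n N * q ^+ ((N - n) * (N * #|X| + 1)).
Proof.
have -> : lifts N = [set t : lift_data N | [&& row_full t.2,
    [forall x, t.1.1 x *m t.2 == t.2 *m B' x] & t.1.2 *m t.2 == g']].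
  apply/setP => t; rewrite !inE; apply/idP/and3P => [lt|[_ Bp gp]].
    by split; [exact: lift_full | case/andP: lt | case/andP: lt].
  by rewrite /is_lift gp Bp.
rewrite (card_triples _ (fun p (B : {ffun X -> 'M[F]_N}) =>
    [forall x, B x *m p == p *m B' x]) (fun p g => g *m p == g')).
transitivity (\sum_(p : 'M[F]_(N, n) | row_full p)
    q ^+ ((N - n) * (N * #|X| + 1))).
  rewrite -natz natr_sum; apply: eq_bigr => p fp.
  rewrite (card_ffun_family (fun x (M : 'M[F]_N) => M *m p == p *m B' x)).
  rewrite card_mulmxr_fiber // natrM !natrX natr_prod.
  under eq_bigr => x _ do rewrite card_mulmxr_fiber //.
  rewrite prodr_const natrX -exprM -exprD natz.
  by congr (_ ^+ _); rewrite cardE; lia.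
rewrite sumr_const -mulr_natl -card_row_free natz; congr (_%:Z * _).
rewrite -[RHS](card_imset _ (@trmx_inj _ _ _)); apply: eq_card => p.
apply/idP/imsetP => [fp|[p' + ->]].
  by exists p^T; rewrite ?trmxK // inE /row_free mxrank_tr.
by rewrite inE unfold_in /row_full mxrank_tr.
Qed.

(** Restriction to the reachable space, written in the basis b, yields a reachable lift of dimension
    p. Conversely such a lift determines g, leaves q^((N - p) n) choices for the linear map and then
    q^((N - p) (N - n)) for each letter. *)
Lemma card_lifts_basis N p (b : 'M[F]_(p, N)) : row_free b ->
  #|[set t in lifts N | (b == reachmx t.1.1 t.1.2)%MS]|
  = (#|rank_lifts p p| *
      (#|F| ^ ((N - p) * n) * #|F| ^ ((N - p) * (N - n) * #|X|)))%N.
Proof.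
move=> fb; have [b' bb'] := row_freeP fb.
have bK m (M : 'M[F]_(m, N)) : (M <= b)%MS -> M *m b' *m b = M.
  by case/submxP => D ->; rewrite -(mulmxA D) bb' mulmx1.
(* As b b' = 1, right multiplication by b' gives the coordinates in the basis b. *)
pose restr (t : lift_data N) : lift_data p :=
  ([ffun x => b *m t.1.1 x *m b'], t.1.2 *m b', b *m t.2).
have restrE t : t \in lifts N -> (b == reachmx t.1.1 t.1.2)%MS ->
    [/\ forall x, b *m t.1.1 x = (restr t).1.1 x *m b,
        t.1.2 = (restr t).1.2 *m b & restr t \in rank_lifts p p].
  move=> lt /eqmxP bW.
  have gE : t.1.2 = (restr t).1.2 *m b.
    by rewrite /= bK // bW (state_reach _ _ [::]).
  have BE x : b *m t.1.1 x = (restr t).1.1 x *m b.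
    rewrite ffunE bK // bW; apply: submx_trans (reachmx_stable _ _ x).
    by rewrite submxMr // bW.
  split=> //; rewrite !inE; move: lt; rewrite inE => /andP[/eqP gp /forallP Bp].
  apply/andP; split.
    apply/andP; split; first by rewrite /= mulmxA bK ?gp // bW (state_reach _ _ [::]).
    apply/forallP => x; have /eqP Bpx := Bp x.
    rewrite [(restr t).2]/= mulmxA -BE -mulmxA Bpx mulmxA; exact: eqxx.
  have eqW : (reachmx (restr t).1.1 (restr t).1.2 *m b :=: b)%MS.
    have := reachmx_mul (restr t).1.2 (fun x => esym (BE x)).
    by rewrite -gE => /eqmx_trans; apply; apply: eqmx_sym.
  rewrite eqn_leq rank_leq_row /= -[X in (X <= _)%N](eqnP fb) -eqW.
  exact: mxrankM_maxl.
rewrite -sum1_card (partition_big restr (mem (rank_lifts p p))) /=; last first.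
  by move=> t; rewrite inE => /andP[lt bt]; case: (restrE t lt bt).
rewrite -sum_nat_const; apply: eq_bigr => s sL.
rewrite sum1_card.
move: (sL); rewrite !inE => /andP[ls /eqP fs].
have fsp : row_full s.2 := lift_full ls.
move/andP: (ls) => [/eqP gs /forallP Bs].
have reach_b (t : lift_data N) :
    (forall x, b *m t.1.1 x = s.1.1 x *m b) -> t.1.2 = s.1.2 *m b ->
    (b == reachmx t.1.1 t.1.2)%MS.
  move=> BE gE; apply/eqmxP; rewrite gE; apply: eqmx_trans.
    2: exact: (reachmx_mul (B := s.1.1) s.1.2 (fun x => esym (BE x))).
  by apply/eqmx_sym/eqmxMfull; rewrite /row_full fs.
(* The fibre of [restr] over s, described by conditions that separate the linear map, the letters
   and the initial vector. *)
transitivity #|[set t : lift_data N | [&& b *m t.2 == s.2,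
    [forall x, (b *m t.1.1 x == s.1.1 x *m b) && (t.1.1 x *m t.2 == t.2 *m B' x)]
    & t.1.2 == s.1.2 *m b]]|.
  apply: eq_card => t; rewrite [RHS]inE unfold_in /= inE.
  apply/andP/and3P => [[/andP[lt bt] /eqP rt]|[/eqP pE /forallP BE /eqP gE]].
    have [BE gE _] := restrE t lt bt; rewrite -rt -gE !eqxx; split=> //.
    move: lt; rewrite inE => /andP[_ /forallP Bp].
    by apply/forallP => x; rewrite BE eqxx Bp.
  have BE1 x : b *m t.1.1 x = s.1.1 x *m b by have /andP[/eqP] := BE x.
  split; [apply/andP; split|].
  - rewrite inE; apply/andP; split; first by rewrite gE -mulmxA pE gs.
    by apply/forallP => x; have /andP[] := BE x.
  - exact: (reach_b t BE1 gE).
  rewrite /restr pE gE -mulmxA bb' mulmx1 (_ : [ffun x => _] = s.1.1).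
    by case: (s) => -[? ?] ?.
  by apply/ffunP => x; rewrite ffunE BE1 -mulmxA bb' mulmx1.
rewrite (card_triples (fun p => b *m p == s.2)
   (fun p (B : {ffun X -> 'M[F]_N}) =>
      [forall x, (b *m B x == s.1.1 x *m b) && (B x *m p == p *m B' x)])
   (fun p g => g == s.1.2 *m b)).
rewrite -(card_mulmxl_fiber s.2 fb) -sum_nat_cond_const.
rewrite big_mkcond [RHS]big_mkcond; apply: eq_bigr => P _;
case: eqP => // bP.
have fP : row_full P.
  by rewrite -sub1mx; apply: submx_trans (submxMl b P); rewrite bP sub1mx.
rewrite (card_ffun_family (fun x (M : 'M[F]_N) =>
  (b *m M == s.1.1 x *m b) && (M *m P == P *m B' x))).
rewrite (_ : [set g | _] = [set s.1.2 *m b]).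
  rewrite cards1 muln1.
  rewrite (eq_bigr (fun=> #|F| ^ ((N - p) * (N - n)))%N) => [|x _]; last first.
    apply: card_mulmx_fiber2 => //; have /eqP Bsx := Bs x.
    by rewrite -mulmxA bP Bsx mulmxA bP.
  by rewrite prod_nat_const -expnM.
by apply/setP => g; rewrite !inE.
Qed.

(** Double count of the pairs formed by a lift and a basis of its reachable space, of dimension
    p. *)
Lemma card_rank_lifts N p :
  #|rank_lifts N p|%:Z * free_count q p p =
  free_count q p N * #|rank_lifts p p|%:Z
     * q ^+ ((N - p) * (n + (N - n) * #|X|)).
Proof.
transitivity (\sum_(t in rank_lifts N p)
    #|[set b : 'M[F]_(p, N) | row_free b && (b == reachmx t.1.1 t.1.2)%MS]|%:Z).
  rewrite (eq_bigr (fun=> free_count q p p)) => [|t]; last first.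
    by rewrite inE => /andP[_ /eqP rt]; exact: card_row_basis.
  by rewrite sumr_const -mulr_natl natz.
transitivity (\sum_(b : 'M[F]_(p, N) | row_free b)
   #|[set t in lifts N | (b == reachmx t.1.1 t.1.2)%MS]|%:Z).
  under eq_bigr => t _ do rewrite -sum1_card -natz natr_sum.
  under [RHS]eq_bigr => b _ do rewrite -sum1_card -natz natr_sum.
  rewrite (exchange_big_dep (fun b : 'M[F]_(p, N) => row_free b)) /=.
    apply: eq_bigr => b fb; apply: eq_bigl => t.
    rewrite !inE fb; case: (is_lift t) => //=.
    apply/andP/idP => [[] //|bW]; split=> //.
    by rewrite -(eqmxP bW) (eqnP fb).
  by move=> t b _; rewrite inE => /andP[].
under eq_bigr => b fb do rewrite card_lifts_basis //.
rewrite sumr_const -mulr_natl -card_row_free natz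
  [X in _ = X%:Z * _ * _]cardsE -!natz.
rewrite !natrM !natrX -exprD mulrA; congr (_ * _ ^+ _).
by rewrite mulnDr mulnA.
Qed.

(** Strong induction on N. All lifts are sorted by the rank of their reachable space; the ranks p <
    N are known by [card_rank_lifts] and induction, and comparison with [sum_lift_count] leaves the
    term p = N. *)
Lemma card_reachable_lifts c N : #|X| = c.+1 ->
  #|rank_lifts N N|%:Z = free_count q N N * lift_count q c n N.
Proof.
move=> cardX; have q1 : 1 < q by exact: (card_finNzRing_gt1 F).
elim/ltn_ind: N => N IHN; rewrite /lift_count.
have [nN|Nn] := leqP n N; last first.
  rewrite mulr0; apply/eqP; rewrite eqz_nat -leqn0.
  apply: (@leq_trans #|lifts N|).
    by apply/subset_leq_card/fintype.subsetP => t; rewrite inE => /andP[].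
  by rewrite leqn0 -eqz_nat card_lifts free_count_eq0 // mul0r.
have sum_rank : #|lifts N|%:Z = \sum_(p < N.+1) #|rank_lifts N p|%:Z.
  rewrite -sum1_card (partition_big (fun t : lift_data N =>
    inord (\rank (reachmx t.1.1 t.1.2)) : 'I_N.+1) predT) //=.
  rewrite -natz natr_sum; apply: eq_bigr => p _; rewrite sum1_card natz.
  congr (_%:Z); apply: eq_card => t; rewrite [RHS]inE; congr (_ && _).
  by rewrite -val_eqE /= inordK // ltnS rank_leq_row.
have := sum_lift_count q c nN; rewrite -cardX -card_lifts sum_rank.
rewrite !big_ord_recr /= subnn mul0n expr0 mulr1.
rewrite (eq_bigr (fun p : 'I_N => #|rank_lifts N p|%:Z)) => [|[p ltp] _] /=.
  by move/addrI => <-; rewrite /lift_count nN.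
(* The number of bases of a space of dimension p is cancelled, which is possible because q > 1. *)
apply: (mulIf (free_count_neq0 p q1)).
by rewrite card_rank_lifts IHN //; ring.
Qed.

End Lifts.
End Reach.

Local Open Scope classical_set_scope.
Local Open Scope ring_scope.

(** * Series and their realizations *)

Section Span.
Variables (K : fieldType) (V : lmodType K).
Implicit Types (G S : set V).

Lemma sub_lspan G : G `<=` lspan G.
Proof. by move=> v Gv S [_]; exact. Qed.

Lemma lspan_min G S : GRing.submod_closed [in S] -> G `<=` S -> lspan G `<=` S.
Proof. by move=> clS GS v; apply. Qed.

Lemma lspan_closed G : GRing.submod_closed [in lspan G].
Proof.
split=> [|a u v /set_mem Gu /set_mem Gv]; apply/mem_set => S [clS GS].
  by have := clS.1; rewrite inE.
have Su := mem_set (Gu S (conj clS GS)); have Sv := mem_set (Gv S (conj clS GS)).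
exact: set_mem (clS.2 a u v Su Sv).
Qed.

Lemma lspan_sum G (I : Type) (r : seq I) (P : pred I) (a : I -> K) (f : I -> V) :
  (forall i, P i -> lspan G (f i)) -> lspan G (\sum_(i <- r | P i) a i *: f i).
Proof.
move=> Gf; have [cl0 clZ] := lspan_closed G; apply/set_mem.
elim/big_ind: _ => [//|u v Gu Gv|i Pi].
  by have := clZ 1 _ _ Gu Gv; rewrite scale1r.
by have := clZ (a i) _ _ (mem_set (Gf i Pi)) cl0; rewrite addr0.
Qed.

Lemma lspanD G u v : lspan G u -> lspan G v -> lspan G (u + v).
Proof.
move=> Gu Gv; have := (lspan_closed G).2 1 u v (mem_set Gu) (mem_set Gv).
by rewrite scale1r inE.
Qed.

Lemma lspanZ G a u : lspan G u -> lspan G (a *: u).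
Proof.
move=> Gu; have [cl0 clZ] := lspan_closed G.
by have := clZ a u 0 (mem_set Gu) cl0; rewrite addr0 inE.
Qed.

Lemma lspan_range (I : finType) (b : I -> V) :
  lspan (range b) = [set v | exists c : I -> K, v = \sum_i c i *: b i].
Proof.
apply/seteqP; split=> [|_ [c ->]]; last first.
  by apply: lspan_sum => i _; apply: sub_lspan; exists i.
apply: lspan_min => [|_ [i _ <-]]; last first.
  exists (fun j => (j == i)%:R); rewrite (bigD1 i) //= eqxx scale1r big1 ?addr0 //.
  by move=> j /negbTE->; rewrite scale0r.
split=> [|a u v]; rewrite !inE.
  by exists (fun=> 0); rewrite big1 // => i _; rewrite scale0r.
case=> c1 -> [c2 ->]; exists (fun i => a * c1 i + c2 i).
rewrite scaler_sumr -big_split /=; apply: eq_bigr => i _.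
by rewrite scalerDl scalerA.
Qed.

Definition lfree n (b : 'I_n -> V) :=
  forall c : 'I_n -> K, \sum_i c i *: b i = 0 -> forall i, c i = 0.

(** The coordinates of e in terms of b form a matrix with m independent rows and n columns. *)
Lemma lfree_leq n m (b : 'I_n -> V) (e : 'I_m -> V) :
  lfree e -> range e `<=` lspan (range b) -> (m <= n)%N.
Proof.
move=> free_e eb.
have /choice[M eM] i : exists c : 'I_n -> K, e i = \sum_j c j *: b j.
  by have := eb (e i); rewrite lspan_range; apply; exists i.
have : row_free (\matrix_(i, j) M i j).
  apply: inj_row_free => v v0; apply/rowP => i; rewrite mxE.
  apply: (free_e (v 0)) => {i}.
  under eq_bigr => i _ do rewrite eM scaler_sumr.
  rewrite exchange_big big1 //= => j _; rewrite -[RHS](scale0r (b j)).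
  under eq_bigr => i _ do rewrite scalerA.
  rewrite -scaler_suml; congr (_ *: _); move/rowP/(_ j): v0.
  by rewrite !mxE => v0j; rewrite -[RHS]v0j; apply: eq_bigr => i _; rewrite mxE.
by move/eqP <-; exact: rank_leq_col.
Qed.

Lemma has_dim_inj S n m : has_dim S n -> has_dim S m -> n = m.
Proof.
move=> [b [fb bS]] [e [fe eS]]; apply/eqP; rewrite eqn_leq; apply/andP; split.
  by apply: (lfree_leq (b := e) fb); rewrite eS -bS; exact: sub_lspan.
by apply: (lfree_leq (b := b) fe); rewrite bS -eS; exact: sub_lspan.
Qed.

Lemma ldim_eq S n : has_dim S n -> ldim S = n.
Proof.
by move=> Sn; apply: (@has_dim_inj S) => //; exact: (xgetI _ Sn).
Qed.

(** The lengths of free families in S are bounded by n, and a free family of maximal length spans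
    S. *)
Lemma has_dim_sub S n (b : 'I_n -> V) :
    GRing.submod_closed [in S] -> S `<=` lspan (range b) ->
  exists2 m, (m <= n)%N & has_dim S m.
Proof.
move=> clS Sb; pose P m := `[< exists e : 'I_m -> V, lfree e /\ range e `<=` S >].
have P0 : P 0%N.
  apply/asboolP; exists (fun=> 0); split=> [c _ []//|_ [[]//]].
have Pn m : P m -> (m <= n)%N.
  by move/asboolP => [e [fe eS]]; apply: (lfree_leq fe); exact: subset_trans Sb.
have exP : exists m, P m by exists 0%N.
case: (ex_maxnP exP Pn) => m Pm maxm; exists m; first exact: Pn.
have /asboolP[e [fe eS]] := Pm; exists e; split=> //.
apply/seteqP; split; first exact: lspan_min.
move=> v Sv; apply: contrapT => ve.
suff /maxm : P m.+1 by rewrite ltnn.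
(* A vector v of S outside the span could be put in front of the maximal family without destroying
   freeness. *)
apply/asboolP; exists (fun i => if unlift ord0 i is Some j then e j else v).
split=> [c|_ [i _ <-]]; last by case: unliftP => [j|] _ //; apply: eS; exists j.
rewrite big_ord_recl unlift_none.
under eq_bigr => i _ do rewrite liftK.
have [c0|c0] := eqVneq (c ord0) 0.
  rewrite c0 scale0r add0r => /fe ce i.
  by case: (unliftP ord0 i) => [j ->|->]; [exact: ce | exact: c0].
move=> ce; case: ve.
have -> : v = - (c ord0)^-1 *: \sum_i c (lift ord0 i) *: e i.
  apply: (scalerI c0); rewrite scalerA mulrN divff // scaleN1r.
  by apply/eqP; rewrite -addr_eq0 ce.
by apply: lspanZ; apply: lspan_sum => i _; apply: sub_lspan; exists i.
Qed.

End Span.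

(** * The minimal realization of a series *)

Section Realization.
Variables (X : finType) (F : finFieldType).
Implicit Types (A : ncseries X F) (w T : seq X).

Definition wordmx N (B : X -> 'M[F]_N) w : 'M[F]_N :=
  foldr (fun x M => M *m B x) 1%:M w.

Lemma stateE N (B : X -> 'M[F]_N) v w : state B v w = v *m wordmx B w.
Proof. by elim: w => [|x w IHw] /=; rewrite ?mulmx1 // IHw mulmxA. Qed.

Lemma state_cat N (B : X -> 'M[F]_N) v w T :
  state B v (w ++ T) = state B (state B v T) w.
Proof. by rewrite /state foldr_cat. Qed.

Definition series N (B : X -> 'M[F]_N) (l : 'cV[F]_N) (v : 'rV[F]_N) :
    ncseries X F :=
  fun w => (state B v w *m l) 0 0.

Lemma rclosure_closed A : GRing.submod_closed [in rclosure A].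
Proof. exact: lspan_closed. Qed.

Lemma rclosure_shift A T : rclosure A (rho T A).
Proof. by apply: sub_lspan; exists T. Qed.

Section Fixed.
Variables (N : nat) (B : X -> 'M[F]_N) (l : 'cV[F]_N).

Lemma series_linear a u v : series B l (a *: u + v) = a *: series B l u + series B l v.
Proof.
apply/funext => w; rewrite ncaddE ncscaleE /series !stateE.
by rewrite !mulmxDl -!scalemxAl !mxE.
Qed.

Lemma series0 : series B l 0 = 0.
Proof. by apply/funext => w; rewrite /series stateE !mul0mx mxE. Qed.

Lemma series_sum (I : finType) (c : I -> F) (v : I -> 'rV[F]_N) :
  series B l (\sum_i c i *: v i) = \sum_i c i *: series B l (v i).
Proof.
elim/big_rec2: _ => [|i A u _ <-]; first exact: series0.
by rewrite series_linear.
Qed.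

Lemma rho_series T v : rho T (series B l v) = series B l (state B v T).
Proof. by apply/funext => w; rewrite /rho /series state_cat. Qed.

(** The linear map [series B l] sends the state reached by T to the shift of the series by T, hence
    the span of the states onto the span of the shifts. *)
Lemma rclosure_series g :
  rclosure (series B l g) = [set series B l v | v in [set v | (v <= reachmx B g)%MS]].
Proof.
apply/seteqP; split.
  apply: lspan_min => [|_ [T _ <-]].
    split=> [|a A1 A2]; rewrite !inE.
      by exists 0; [exact: sub0mx | exact: series0].
    case=> u /= uB <- [v /= vB <-]; exists (a *: u + v); last exact: series_linear.
    by rewrite addmx_sub // scalemx_sub.
  by exists (state B g T); [exact: state_reach | rewrite rho_series].
(* U is spanned by the vectors whose series belong to the closure. It contains all states, therefore
   the reachable space. *)
pose U : 'M[F]_N :=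
  (\sum_(v : 'rV[F]_N | `[< rclosure (series B l g) (series B l v) >]) <<v>>)%MS.
move=> _ [v /= vB <-].
have : (v <= U)%MS.
  apply: submx_trans vB _; apply: reachmx_sub => w.
  apply: (sumsmx_sup (state B g w)); last by rewrite genmxE.
  by apply/asboolP; rewrite -rho_series; exact: rclosure_shift.
case/sub_sumsmxP => u ->.
have lsp i : `[< rclosure (series B l g) (series B l i) >] ->
    rclosure (series B l g) (series B l (u i *m <<i>>%MS)).
  move/asboolP => ri; have /sub_rVP[a ->] : (u i *m <<i>>%MS <= i)%MS.
    by apply: submx_trans (submxMl _ _) _; rewrite genmxE.
  have := series_linear a i 0; rewrite addr0 series0 addr0 => ->.
  exact: lspanZ.
elim/big_ind: _ => [|v1 v2 Hv1 Hv2|i ri].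
- rewrite series0; have := (rclosure_closed (series B l g)).1.
  by rewrite inE.
- have := series_linear 1 v1 v2; rewrite !scale1r => ->; exact: lspanD.
- exact: lsp.
Qed.

End Fixed.

Definition observable N (B : X -> 'M[F]_N) (l : 'cV[F]_N) :=
  forall v, series B l v = 0 -> v = 0.

Lemma rclosure_rho A T B : rclosure A B -> rclosure A (rho T B).
Proof.
move: B; apply: lspan_min => [|_ [S _ <-]].
  have [cl0 clZ] := rclosure_closed A.
  split=> [|a A1 A2]; rewrite !inE.
    by move: cl0; rewrite inE.
  by move=> A1P A2P; exact: (lspanD (lspanZ a A1P) A2P).
rewrite (_ : rho T (rho S A) = rho (T ++ S) A); first exact: rclosure_shift.
by apply/funext => w; rewrite /rho catA.
Qed.

(** The closure of A is itself the state space: letters act by [rho], the initial vector is A, the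
    output form is the constant coefficient. Each state is then its own series, whence
    observability. *)
Lemma minimal_realization A n : has_dim (rclosure A) n ->
  exists (B : {ffun X -> 'M[F]_n}) (l : 'cV[F]_n) (g : 'rV[F]_n),
    [/\ series B l g = A, reachable B g & observable B l].
Proof.
move=> [b [fb bA]].
have coord s : rclosure A s -> exists c : 'rV[F]_n, s = \sum_i c 0 i *: b i.
  rewrite -bA lspan_range => -[c ->]; exists (\row_i c i).
  by apply: eq_bigr => i _; rewrite mxE.
have bR i : rclosure A (b i) by rewrite -bA; apply: sub_lspan; exists i.
have /choice[M ME] (xi : X * 'I_n) : exists c : 'rV[F]_n,
    rho [:: xi.1] (b xi.2) = \sum_j c 0 j *: b j.
  by apply: coord; exact: rclosure_rho.
have [g gE] : exists g : 'rV[F]_n, A = \sum_i g 0 i *: b i.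
  apply: coord; rewrite {2}(_ : A = rho [::] A); first exact: rclosure_shift.
  by apply/funext => w; rewrite /rho cats0.
pose B := [ffun x => \matrix_(i, j) M (x, i) 0 j].
pose l : 'cV[F]_n := \col_i b i [::].
pose comb (v : 'rV[F]_n) : ncseries X F := \sum_i v 0 i *: b i.
have combE v w : comb v w = \sum_i v 0 i * b i w.
  by rewrite /comb; elim/big_rec2: _ => // i a s _ <-.
have seriesE v : series B l v = comb v.
  (* The induction removes the last letter of w, the first one to act on the state. *)
  apply/funext => w; elim/last_ind: w v => [|w x IHw] v.
    by rewrite combE /series /= mxE; apply: eq_bigr => i _; rewrite mxE.
  rewrite -cats1 {1}/series state_cat -[LHS]/(series B l (v *m B x) w) IHw.
  rewrite !combE; under [RHS]eq_bigr => i _ do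
    rewrite -[b i _]/(rho [:: x] (b i) w) (ME (x, i))
      -[X in _ * X]/(comb (M (x, i)) w) combE mulr_sumr.
  rewrite exchange_big; apply: eq_bigr => j _ /=.
  rewrite mxE mulr_suml; apply: eq_bigr => i _.
  by rewrite ffunE mxE mulrA.
have comb0 v : comb v = 0 -> v = 0.
  by move/fb => v0; apply/rowP => i; rewrite v0 mxE.
exists B, l, g; split; first by rewrite seriesE gE.
  (* Each basis series is, by [rclosure_series], the series of some reachable vector, and that
     vector is the basis vector by injectivity. *)
  rewrite /reachable -sub1mx; apply/row_subP => i.
  have : rclosure A (comb (row i 1%:M)).
    by rewrite -bA /comb; apply: lspan_sum => j _; apply: sub_lspan; exists j.
  rewrite -[A in rclosure A](_ : series B l g = A); last by rewrite seriesE gE.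
  rewrite rclosure_series => -[v /= vB]; rewrite seriesE => cv.
  suff <- : v = row i 1%:M by [].
  apply/eqP; rewrite -subr_eq0; apply/eqP/comb0.
  rewrite /comb; under eq_bigr => j _ do rewrite mxE scalerDl mxE scaleNr.
  by rewrite sumrB -/(comb _) -/(comb _) cv subrr.
by move=> v; rewrite seriesE; exact: comb0.
Qed.

End Realization.

(** * Reachable realizations of a given series *)

Section Realizations.
Variables (X : finType) (F : finFieldType).
Implicit Types (A : ncseries X F).
Local Notation q := (#|F|%:Z).

Definition realization N := ({ffun X -> 'M[F]_N} * 'rV[F]_N * 'cV[F]_N)%type.

Definition realized N (t : realization N) : ncseries X F := series t.1.1 t.2 t.1.2.

Definition reachables N : {set realization N} :=
  [set t : realization N | reachable t.1.1 t.1.2]%SET.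

(** With a generalized inverse L' of L, the rows of 1 - L L' are relations between the rows of L,
    hence between those of R, so that R = L L' R. *)
Lemma factor_mulmx m N n (L : 'M[F]_(m, N)) (R : 'M[F]_(m, n)) :
  (forall u : 'rV_m, u *m L = 0 -> u *m R = 0) -> exists p, R = L *m p.
Proof.
move=> LR; have [L' LL'] : exists L', L *m L' *m L = L.
  by exists (pinvmx L); rewrite mulmxKpV ?submx_refl.
exists (L' *m R); apply/eqP; rewrite -subr_eq0 mulmxA -{1}[R]mul1mx -mulmxBl.
apply/eqP/row_matrixP => i; rewrite row_mul row0; apply: LR.
by rewrite -row_mul mulmxBl mul1mx LL' subrr row0.
Qed.

Lemma reachable_eq N m (B : X -> 'M[F]_N) g (p r : 'M[F]_(N, m)) :
  reachable B g -> (forall w, state B g w *m p = state B g w *m r) -> p = r.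
Proof.
move=> rB pr; apply: (row_full_inj rB); apply/eqP; rewrite -subr_eq0 -mulmxBr.
by apply/eqP/reachmx_mul0 => w; rewrite mulmxBr pr subrr.
Qed.

Lemma state_row_mx N n (B : X -> 'M[F]_N) (B' : X -> 'M[F]_n) u v w :
  state (fun x => block_mx (B x) 0 0 (B' x)) (row_mx u v) w =
  row_mx (state B u w) (state B' v w).
Proof.
by elim: w => //= x w ->; rewrite mul_row_block !mulmx0 addr0 add0r.
Qed.

Lemma state0 N (B : X -> 'M[F]_N) w : state B 0 w = 0.
Proof. by rewrite stateE mul0mx. Qed.

(* The reachable space of the direct sum of two realizations of one series is
   the graph of a linear map. *)
Lemma lift_exists N n (B : X -> 'M[F]_N) g l (B' : X -> 'M[F]_n) g' l' :
    observable B' l' -> series B l g = series B' l' g' ->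
  exists p : 'M_(N, n), forall w, state B' g' w = state B g w *m p.
Proof.
move=> obs eqA.
pose D x := block_mx (B x) 0 0 (B' x); pose W := reachmx D (row_mx g g').
(* The difference of the two outputs vanishes on every reachable vector of the direct sum, and still
   does after reading any word u. *)
have W0 u : W *m (wordmx D u *m col_mx l (- l')) = 0.
  apply: reachmx_mul0 => w; rewrite mulmxA -stateE -state_cat state_row_mx.
  rewrite mul_row_col mulmxN; apply/eqP; rewrite subr_eq0; apply/eqP/matrixP => i j.
  by rewrite !ord1; exact: (congr1 (fun A : ncseries X F => A (u ++ w)) eqA).
have [L [R WE]] : exists L R, W = row_mx L R.
  by exists (lsubmx W), (rsubmx W); rewrite hsubmxK.
(* W is a graph: an element with zero first component has a second component with zero series, which
   is zero by observability. *)
have [u uL|p Rp] := @factor_mulmx _ _ _ L R.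
  apply: obs; apply/funext => w.
  suff s0 : state B' (u *m R) w *m l' = 0.
    by rewrite -[LHS]/((state B' (u *m R) w *m l') 0 0) s0 mxE.
  have := congr1 (mulmx u) (W0 w); rewrite mulmx0 !mulmxA -stateE WE mul_mx_row.
  rewrite uL state_row_mx state0 mul_row_col mul0mx add0r mulmxN.
  by move/eqP; rewrite oppr_eq0 => /eqP.
exists p => w; have := state_reach D (row_mx g g') w.
rewrite -/W state_row_mx WE => /submxP[u]; rewrite mul_mx_row Rp.
by case/eq_row_mx => -> ->; rewrite mulmxA.
Qed.

(** Reachable realizations of A correspond to reachable lifts of its minimal realization:
    [lift_exists] provides the linear map, reachability makes it unique, and it determines the
    output form. *)
Lemma card_realizations A n N c : #|X| = c.+1 -> has_dim (rclosure A) n ->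
  #|[set t in reachables N | `[< realized t = A >]]%SET|%:Z
  = free_count q N N * lift_count q c n N.
Proof.
move=> cardX /minimal_realization[B' [l' [g' [<- reach' obs']]]].
rewrite -(card_reachable_lifts reach' N cardX); congr (_%:Z).
pose f (t : lift_data X F n N) : realization N := (t.1, t.2 *m l').
have f_inj : {in rank_lifts B' g' N N &, injective f}.
  move=> [[B g] p] [[B2 g2] r]; rewrite !inE /= => /andP[/andP[/eqP gp /forallP Bp] rB].
  case/andP=> /andP[/eqP gr /forallP Br] _ [eB eg _]; rewrite -eB -eg /= in gr Br *.
  congr (_, _); apply: (reachable_eq (B := B) (g := g) rB) => w.
  rewrite (state_mul g w (fun x => eqP (Bp x))) gp.
  by rewrite (state_mul g w (fun x => eqP (Br x))) gr.
rewrite -(card_in_imset f_inj); apply: eq_card => t.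
apply/idP/imsetP => [|[s + ->]]; rewrite !inE.
  case/andP => rt /asboolP tA.
  have [p pE] := lift_exists obs' tA.
  have lE : t.2 = p *m l'.
    apply: (reachable_eq rt) => w; rewrite mulmxA -pE.
    apply/matrixP => i j; rewrite !ord1.
    exact: (congr1 (fun A : ncseries X F => A w) tA).
  exists (t.1, p); last by rewrite /f -lE; case: (t).
  rewrite !inE; apply/andP; split; last exact: rt.
  apply/andP; split; first by rewrite -(pE [::]).
  apply/forallP => x; apply/eqP; apply: (reachable_eq rt) => w.
  by rewrite !mulmxA -(pE w) -(pE (x :: w)).
case/andP => /andP[/eqP gp /forallP Bp] rs; apply/andP; split; first exact: rs.
apply/asboolP/funext => w; rewrite /realized /series /= mulmxA.
by rewrite (state_mul _ w (fun x => eqP (Bp x))) gp.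
Qed.

(** Every pair (B, g) is in exactly one way a lift of the realization of dimension 0, so
    [card_reachable_lifts] applies with n = 0. The output form is arbitrary and accounts for q^N. *)
Lemma card_reachables c N : #|X| = c.+1 ->
  #|reachables N|%:Z = q ^+ N * (free_count q N N * forest_count q c N 1).
Proof.
move=> cardX.
pose pairs := [set s : {ffun X -> 'M[F]_N} * 'rV[F]_N | reachable s.1 s.2]%SET.
have -> : reachables N = finset.setX pairs [set: 'cV[F]_N]%SET.
  by apply/setP => t; rewrite !inE andbT.
rewrite cardsX cardsT card_mx muln1 PoszM mulrC; congr (_ * _).
  by rewrite -natz natrX natz.
pose B0 : {ffun X -> 'M[F]_0} := [ffun=> 0].
have reach0 : reachable B0 (0 : 'rV_0) by rewrite /reachable -col_leq_rank.
have := card_reachable_lifts reach0 N cardX.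
rewrite /lift_count leq0n subn0 mul0n addn0 => <-; congr (_%:Z).
have -> : rank_lifts B0 0 N N = finset.setX pairs [set: 'M[F]_(N, 0)]%SET.
  apply/setP => t; rewrite !inE andbT; apply: andb_idl => _.
  apply/andP; split; first by apply/eqP; rewrite thinmx0.
  by apply/forallP => x; apply/eqP; rewrite [LHS]thinmx0 [RHS]thinmx0.
by rewrite cardsX cardsT card_mx muln0 muln1.
Qed.

End Realizations.

(** * The triangular system for the numbers of series *)

Section Complexity.
Variables (X : finType) (F : finFieldType) (c : nat).
Hypothesis cardX : #|X| = c.+1.
Implicit Types (A : ncseries X F).
Local Notation q := (#|F|%:Z).

Definition of_complexity n : set (ncseries X F) :=
  [set A | has_dim (rclosure A) n].

Lemma finite_of_complexity n : finite_set (of_complexity n).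
Proof.
apply: (@sub_finite_set _ _ [set realized t | t in [set: realization X F n]]).
  move=> A /minimal_realization[B [l [g [<- _ _]]]].
  by exists (B, g, l).
exact/finite_image/finite_finset.
Qed.

Lemma complexity_leq N (t : realization X F N) :
  exists2 n, (n <= N)%N & of_complexity n (realized t).
Proof.
pose b i := series t.1.1 t.2 (delta_mx 0 i).
apply: (has_dim_sub (b := b)); first exact: rclosure_closed.
rewrite rclosure_series => _ [v _ <-].
rewrite [v]row_sum_delta series_sum; apply: lspan_sum => i _.
by apply: sub_lspan; exists i.
Qed.

(** Each reachable realization of dimension N realizes exactly one series, whose complexity n is at
    most N. Grouping realizations by their series gives the identity multiplied by the order of
    GL_N. *)
Lemma sum_of_complexity N :
  \sum_(n < N.+1) #|` fset_set (of_complexity n)|%:Z *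
      forest_count q c (N - n) (1 + n * c)
  = q ^+ N * forest_count q c N 1.
Proof.
have q1 : 1 < q by exact: (card_finNzRing_gt1 F).
apply: (mulfI (free_count_neq0 N q1)).
rewrite mulrCA -(card_reachables F N cardX) mulr_sumr.
pose Sn n := enum_fset (fset_set (of_complexity n)).
have memSn n A : (A \in Sn n) = `[< of_complexity n A >].
  rewrite /Sn (in_fset_set (finite_of_complexity n)).
  by apply/idP/asboolP => [/set_mem|/mem_set].
transitivity (\sum_(n < N.+1) \sum_(A <- Sn n)
   \sum_(t in reachables X F N) (realized t == A)%:R : int).
  apply: eq_bigr => n _.
  rewrite (eq_big_seq (fun=> free_count q N N * lift_count q c n N)); last first.
    move=> A; rewrite memSn => /asboolP An.
    rewrite -(card_realizations N cardX An) -natr_sum -natz; congr (_%:R).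
    rewrite -sum1_card [RHS]big_mkcond [LHS]big_mkcond; apply: eq_bigr => t _.
    have -> : (realized t == A) = `[< realized t = A >] by exact/eqP/asboolP.
    by rewrite [in RHS]inE; case: (t \in _) => //=; case: `[< _ >].
  rewrite big_const_seq count_predT iter_addr_0 /lift_count leq_ord.
  by rewrite -mulr_natl natz mulrCA.
transitivity (\sum_(t in reachables X F N) \sum_(n < N.+1)
   \sum_(A <- Sn n) (realized t == A)%:R : int).
  under eq_bigr => n _ do rewrite exchange_big.
  by rewrite exchange_big.
rewrite -sum1_card -natz natr_sum; apply: eq_bigr => t _.
have [n nN tn] := complexity_leq t.
have -> : 1%:R = (1 : int) by [].
have sumSn m : \sum_(A <- Sn m) (realized t == A)%:R =
    `[< of_complexity m (realized t) >]%:R :> int.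
  rewrite -memSn -natr_sum; congr (_%:R).
  rewrite -(count_uniq_mem _ (fset_uniq _)) -sum1_count [RHS]big_mkcond /=.
  by apply: eq_bigr => A _; rewrite eq_sym; case: (_ == _).
under eq_bigr => m _ do rewrite sumSn.
have nN1 : (n < N.+1)%N by [].
rewrite (bigD1 (Ordinal nN1)) //= (asboolT tn) big1 ?addr0 // => m mn.
rewrite asboolF // => tm; case/eqP: mn; apply: val_inj => /=.
exact: has_dim_inj tm tn.
Qed.

End Complexity.

(** * Rational series *)

Lemma ncmulr_nil (X : eqType) (K : comNzRingType) (A B : ncseries X K) :
  (A * B) [::] = A [::] * B [::].
Proof. exact: ncmul_nil. Qed.

Lemma ncmul_letter (X : eqType) (K : comNzRingType) (C A : ncseries X K) a x w :
    C [::] = 0 ->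
    (forall v, C (x :: v) = if nilp v then a else 0) -> (C * A) (x :: w) = a * A w.
Proof.
move=> C0 Cx; rewrite ncmulE big_ord_recl C0 mul0r add0r big_ord_recl /=.
rewrite Cx take0 drop0 big1 ?addr0 // => i _.
by rewrite /= Cx; case: w i => [[]|y w i] //=; rewrite mul0r.
Qed.

(** * Inversion by geometric series *)

Section Inverse.
Variables (X : eqType) (K : comNzRingType) (M : ncseries X K).
Hypothesis M0 : M [::] = 0.

Lemma ncexp_eq0 p w : (size w < p)%N -> (M ^+ p) w = 0.
Proof.
elim: p w => // p IHp w ltwp; rewrite exprS ncmulE big_ord_recl take0 M0 mul0r add0r.
rewrite big1 // => i _; rewrite IHp ?mulr0 // size_drop lift0.
by have := ltn_ord i; lia.
Qed.

Lemma one_sub_invertible : exists D, (1 - M) * D = 1 /\ D * (1 - M) = 1.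
Proof.
pose P n := \sum_(p < n) M ^+ p.
(* [D] is the infinite geometric series: powers of exponent greater than the length of w do not
   contribute at w, as M has zero constant coefficient. *)
pose D : ncseries X K := fun w => P (size w).+1 w.
have PE n w : P n w = \sum_(p < n) (M ^+ p) w.
  by rewrite /P; elim/big_rec2: _ => // p a s _ <-.
have DE n w : (size w <= n)%N -> D w = P n.+1 w.
  move=> /subnKC <-; rewrite /D !PE -addSn big_split_ord /= [X in _ + X]big1 ?addr0 //.
  by move=> p _; rewrite ncexp_eq0 // ltnS leq_addr.
have MP n : (1 - M) * P n = 1 - M ^+ n.
  by rewrite -opprB mulNr -subrX1 opprB.
have PM n : P n * (1 - M) = 1 - M ^+ n.
  rewrite -MP; apply: commr_sym; apply: commr_sum => p _.
  apply: commrX; apply: commr_sym.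
  by apply: commrB; [exact: commr1 | exact: commr_refl].
have one_sub w : (1 - M ^+ (size w).+1 : ncseries X K) w = (1 : ncseries X K) w.
  by rewrite ncaddE -[(- _) w]/(- (M ^+ (size w).+1) w) ncexp_eq0 // subr0.
exists D; split; apply/funext => w; rewrite -[RHS]one_sub.
  rewrite -MP !ncmulE; apply: eq_bigr => i _; rewrite (@DE (size w)) //.
  by rewrite size_drop leq_subr.
rewrite -PM !ncmulE; apply: eq_bigr => i _; rewrite (@DE (size w)) //.
by rewrite size_take_min geq_minr.
Qed.

End Inverse.

(** * Rationality and finite-dimensional closure *)

Section Rational.
Variables (X : finType) (K : fieldType).
Implicit Types (A B C : ncseries X K).
Local Notation rat := (@rational_series X K).

Lemma rational_closed : GRing.subalg_closed [in rat] /\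
  forall A B, rat A -> A * B = 1 -> B * A = 1 -> rat B.
Proof.
split; first split.
- by apply/mem_set => S [[[+ _ _] _] _]; rewrite inE.
- move=> a u v /set_mem ru /set_mem rv; apply/mem_set => S SC.
  have [[[_ SZ _] _] _] := SC.
  by have := SZ a u v (mem_set (ru S SC)) (mem_set (rv S SC)); rewrite inE.
- move=> u v /set_mem ru /set_mem rv; apply/mem_set => S SC.
  have [[[_ _ SM] _] _] := SC.
  by have := SM u v (mem_set (ru S SC)) (mem_set (rv S SC)); rewrite inE.
move=> A B rA AB BA S SC; have [[_ SI] _] := SC.
by have := SI A B (mem_set (rA S SC)) AB BA; rewrite inE.
Qed.

Lemma rational1 : rat 1.
Proof. by have [[+ _ _] _] := rational_closed; rewrite inE. Qed.

Lemma rationalM A B : rat A -> rat B -> rat (A * B).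
Proof.
move=> rA rB; have [[_ _ cM] _] := rational_closed.
by have := cM A B (mem_set rA) (mem_set rB); rewrite inE.
Qed.

Lemma rational_scaleD a A B : rat A -> rat B -> rat (a *: A + B).
Proof.
move=> rA rB; have [[_ cZ _] _] := rational_closed.
by have := cZ a A B (mem_set rA) (mem_set rB); rewrite inE.
Qed.

Lemma rationalD A B : rat A -> rat B -> rat (A + B).
Proof. by move=> rA rB; have := rational_scaleD 1 rA rB; rewrite scale1r. Qed.

Lemma rational0 : rat 0.
Proof. by have := rational_scaleD (- 1) rational1 rational1; rewrite scaleN1r addNr. Qed.

Lemma rationalZ a A : rat A -> rat (a *: A).
Proof. by move=> rA; have := rational_scaleD a rA rational0; rewrite addr0. Qed.

Lemma rational_sum (I : Type) (r : seq I) (P : pred I) (f : I -> ncseries X K) :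
  (forall i, P i -> rat (f i)) -> rat (\sum_(i <- r | P i) f i).
Proof. by move=> rf; elim/big_ind: _ => //; [exact: rational0 | exact: rationalD]. Qed.

Lemma rational_var x : rat (@ncvar X K x).
Proof. by move=> S [_]; apply; exists x. Qed.

(* Gaussian elimination over a noncommutative ring: 1 - M 0 0 is invertible. *)
Lemma rational_system n (M : 'I_n -> 'I_n -> ncseries X K) (g S : 'I_n -> ncseries X K) :
    (forall i j, rat (M i j)) -> (forall i j, M i j [::] = 0) ->
    (forall i, rat (g i)) -> (forall i, S i = g i + \sum_j M i j * S j) ->
  forall i, rat (S i).
Proof.
elim: n M g S => [|n IHn] M g S rM M0 rg SE; first by case.
have [D [CD DC]] := one_sub_invertible (M0 ord0 ord0).
have rD : rat D.
  apply: (rational_closed.2 (1 - M ord0 ord0)) => //.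
  by rewrite addrC -scaleN1r; apply: rational_scaleD => //; exact: rational1.
pose L := lift (@ord0 n).
have S0 : S ord0 = D * (g ord0 + \sum_j M ord0 (L j) * S (L j)).
  have : (1 - M ord0 ord0) * S ord0 = g ord0 + \sum_j M ord0 (L j) * S (L j).
    by rewrite mulrBl mul1r {1}SE big_ord_recl addrCA addrAC subrr add0r.
  by move=> <-; rewrite mulrA DC mul1r.
have rSL i : rat (S (L i)).
  (* Substituting the expression for the first unknown leaves n equations whose coefficients again
     have zero constant term. *)
  apply: (IHn (fun i j => M (L i) (L j) + M (L i) ord0 * D * M ord0 (L j))
              (fun i => g (L i) + M (L i) ord0 * D * g ord0)
              (fun i => S (L i))) => {i} [i j|i j|i|i].
  - by apply: rationalD => //; do !apply: rationalM.
  - by rewrite ncaddE -!mulrA ncmulr_nil !M0 mul0r addr0.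
  - by apply: rationalD => //; do !apply: rationalM.
  - rewrite [LHS]SE big_ord_recl S0 mulrA mulrDr -!addrA; congr (_ + (_ + _)).
    under [RHS]eq_bigr => j _ do rewrite mulrDl.
    rewrite big_split /= addrC mulr_sumr; congr (_ + _).
    by apply: eq_bigr => j _; rewrite !mulrA.
move=> i; case: (unliftP ord0 i) => [j|] ->; first exact: rSL.
rewrite S0; apply: rationalM => //; apply: rationalD => //.
by apply: rational_sum => j _; apply: rationalM.
Qed.

(** A lies in a finitely generated space stable under the shifts by letters. The index type is
    arbitrary, so that sum and option types can index the families built for products and
    inverses. *)
Definition finite_rank A := exists (I : finType) (b : I -> ncseries X K),
  lspan (range b) A /\ forall x i, lspan (range b) (rho [:: x] (b i)).

Lemma rho_sum T (I : Type) (r : seq I) (P : pred I) (a : I -> K) (f : I -> ncseries X K) :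
  rho T (\sum_(i <- r | P i) a i *: f i) = \sum_(i <- r | P i) a i *: rho T (f i).
Proof. by elim/big_rec2: _ => // i A B _ <-. Qed.

(** In a factorization of a word ending in x, this letter belongs to the right factor unless that
    factor is empty. *)
Lemma rho_mul x A B : rho [:: x] (A * B) = A * rho [:: x] B + B [::] *: rho [:: x] A.
Proof.
apply/funext => w; rewrite ncaddE ncscaleE /rho !ncmulE size_cat addn1 big_ord_recr /=.
rewrite take_oversize ?size_cat ?addn1 // drop_oversize ?size_cat ?addn1 //.
rewrite [X in _ + X]mulrC; congr (_ + _).
apply: eq_bigr => i _; have iw : (i <= size w)%N by rewrite -ltnS.
rewrite takel_cat // drop_cat; case: ltnP => // wi.
have -> : nat_of_ord i = size w by apply/eqP; rewrite eqn_leq iw.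
by rewrite subnn drop0 drop_size.
Qed.

Lemma lspan_mono (V : lmodType K) (G H : set V) : G `<=` H -> lspan G `<=` lspan H.
Proof.
move=> GH; apply: lspan_min; first exact: lspan_closed.
exact: subset_trans GH (@sub_lspan _ _ _).
Qed.

Lemma lspan_stable (I : finType) (b : I -> ncseries X K) x A :
  (forall i, lspan (range b) (rho [:: x] (b i))) -> lspan (range b) A ->
  lspan (range b) (rho [:: x] A).
Proof.
move=> bx; rewrite {1}lspan_range => -[c ->]; rewrite rho_sum.
exact: lspan_sum.
Qed.

Lemma lspan_mull (I : finType) (b : I -> ncseries X K) C A :
  lspan (range b) A -> lspan (range (fun i => C * b i)) (C * A).
Proof.
rewrite {1}lspan_range => -[c ->]; rewrite mulr_sumr.
under eq_bigr => i _ do rewrite -scalerAr.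
by apply: lspan_sum => i _; apply: sub_lspan; exists i.
Qed.

(** Series of finite rank contain the letters and are closed under the operations. If b and e serve
    for u and v, then b together with u e serves for u v; for the inverse v of u, the family v b
    together with v does. *)
Lemma rational_finite_rank A : rat A -> finite_rank A.
Proof.
have rho1 x : rho [:: x] (1 : ncseries X K) = 0.
  by apply/funext => w; rewrite /rho cats1; case: w.
have lspan0 G : lspan G (0 : ncseries X K).
  by have := (lspan_closed G).1; rewrite inE.
move=> rA; apply/set_mem; move: A rA.
suff : rat `<=` finite_rank by move=> sub A /sub/mem_set.
move=> A; apply; split; last first.
  move=> _ [x _ <-]; exists bool, (fun b => if b then 1 else ncvar K x); split.
    by apply: sub_lspan; exists false.
  move=> y [|] ; first by rewrite rho1.
  rewrite (_ : rho _ _ = (x == y)%:R *: 1).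
    by apply: lspanZ; apply: sub_lspan; exists true.
  apply/funext => -[|z w]; rewrite ncscaleE /rho /ncvar.
    by rewrite /= eqseq_cons eqxx andbT mulr1 eq_sym.
  by rewrite /= eqseq_cons andbC; case: w => [|? ?]; rewrite /= mulr0.
split; first split.
- rewrite inE; exists unit, (fun=> 1); split; first by apply: sub_lspan; exists tt.
  by move=> x _; rewrite rho1.
- move=> a u v /set_mem[I [b [ub bx]]] /set_mem[J [e [ve ex]]]; rewrite inE.
  pose be (k : I + J) := match k with inl i => b i | inr j => e j end.
  have sb : lspan (range b) `<=` lspan (range be).
    by apply: lspan_mono => _ [i _ <-]; exists (inl i).
  have se : lspan (range e) `<=` lspan (range be).
    by apply: lspan_mono => _ [j _ <-]; exists (inr j).
  exists (I + J)%type, be; split.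
    by apply: lspanD; [by apply: lspanZ; exact: sb | exact: se].
  by move=> x [i|j]; [exact: sb (bx x i) | exact: se (ex x j)].
- move=> u v /set_mem[I [b [ub bx]]] /set_mem[J [e [ve ex]]]; rewrite inE.
  pose be (k : I + J) := match k with inl i => b i | inr j => u * e j end.
  have sb : lspan (range b) `<=` lspan (range be).
    by apply: lspan_mono => _ [i _ <-]; exists (inl i).
  have se w : lspan (range e) w -> lspan (range be) (u * w).
    move=> /(@lspan_mull _ _ u); apply: lspan_mono => _ [j _ <-]; by exists (inr j).
  exists (I + J)%type, be; split; first exact: se.
  move=> x [i|j]; first exact: sb (bx x i).
  rewrite /= rho_mul; apply: lspanD; first exact: se (ex x j).
  by apply: lspanZ; apply: sb; exact: lspan_stable.
move=> u v /set_mem[I [b [ub bx]]] uv vu; rewrite inE.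
pose be (k : option I) := if k is Some i then v * b i else v.
have sb w : lspan (range b) w -> lspan (range be) (v * w).
  by move=> /(@lspan_mull _ _ v); apply: lspan_mono => _ [i _ <-]; exists (Some i).
(* Shifting u v = 1 by a letter and multiplying by v on the left expresses the shift of v as a
   scalar multiple of v times the shift of u. *)
have rho_v x : lspan (range be) (rho [:: x] v).
  have : v * rho [:: x] (u * v) = 0 by rewrite uv rho1 mulr0.
  rewrite rho_mul mulrDr mulrA vu mul1r -scalerAr => /eqP.
  rewrite addr_eq0 -scaleNr => /eqP ->; apply: lspanZ; apply: sb.
  exact: lspan_stable.
exists (option I), be; split; first by apply: sub_lspan; exists None.
move=> x [i|] //=; rewrite rho_mul; apply: lspanD; first exact: sb (bx x i).
exact: lspanZ.
Qed.

Lemma finite_rank_dim A : finite_rank A -> exists n, has_dim (rclosure A) n.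
Proof.
move=> [I [b [bA bx]]].
have bT T : lspan (range b) (rho T A).
  elim: T => [|x T IHT].
    by rewrite (_ : rho [::] A = A) //; apply/funext => w; rewrite /rho cats0.
  rewrite (_ : rho (x :: T) A = rho [:: x] (rho T A)); first exact: lspan_stable.
  by apply/funext => w; rewrite /rho -catA.
have [n _ An] : exists2 n, (n <= #|I|)%N & has_dim (rclosure A) n.
  apply: (has_dim_sub (b := fun i : 'I_#|I| => b (enum_val i))).
    exact: lspan_closed.
  apply: lspan_min => [|_ [T _ <-]]; first exact: lspan_closed.
  apply: lspan_mono (bT T) => _ [i _ <-]; exists (enum_rank i) => //.
  by rewrite enum_rankK.
by exists n.
Qed.

End Rational.

(** The coordinates of the state, seen as series in w, solve a linear system whose coefficients are
    linear combinations of letters: the first letter of w acts last. [rational_system] applies, and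
    A is a linear combination of these coordinates. *)
Lemma has_dim_rational (X : finType) (F : finFieldType) (A : ncseries X F) n :
  has_dim (rclosure A) n -> rational_series A.
Proof.
move=> /minimal_realization[B [l [g [<- _ _]]]].
pose S i : ncseries X F := fun w => state B g w 0 i.
pose M i j : ncseries X F := \sum_x B x j i *: ncvar F x.
have ME i j w : M i j w = \sum_x B x j i * ncvar F x w.
  by rewrite /M; elim/big_rec2: _ => // x a s _ <-.
have M0 i j : M i j [::] = 0 by rewrite ME big1 // => x _; rewrite mulr0.
have Mx i j x v : M i j (x :: v) = if nilp v then B x j i else 0.
  rewrite ME (bigD1 x) //= big1 ?addr0 => [|y /negbTE yx].
    by rewrite /ncvar eqseq_cons eqxx /=; case: v => [|? ?]; rewrite ?mulr1 ?mulr0.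
  by rewrite /ncvar eqseq_cons eq_sym yx mulr0.
have rS : forall i, rational_series (S i).
  apply: (@rational_system _ _ _ M (fun i => g 0 i *: 1)) => [i j|//|i|i].
  - apply: rational_sum => x _; apply: rationalZ; exact: rational_var.
  - by apply: rationalZ; exact: rational1.
  apply/funext => w; rewrite ncaddE ncscaleE.
  have -> : (\sum_j M i j * S j) w = \sum_j (M i j * S j) w.
    by elim/big_rec2: _ => // j a s _ <-.
  case: w => [|x w].
    by rewrite mulr1 big1 ?addr0 // => j _; rewrite ncmulr_nil M0 mul0r.
  rewrite mulr0 add0r /S /= mxE; apply: eq_bigr => j _.
  by rewrite (@ncmul_letter _ _ _ _ (B x j i)) // mulrC.
have -> : series B l g = \sum_i l i 0 *: S i.
  apply/funext => w; have -> : (\sum_i l i 0 *: S i) w = \sum_i l i 0 * S i w.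
    by elim/big_rec2: _ => // j a s _ <-.
  by rewrite /series mxE; apply: eq_bigr => i _; rewrite mulrC.
by apply: rational_sum => i _; apply: rationalZ.
Qed.

(** * Trees *)

Section WordOrder.
Variables (d : Order.disp_t) (X : finOrderType d).
Implicit Types (u v w : seq X).

Lemma word_lt_trans v u w : word_lt u v -> word_lt v w -> word_lt u w.
Proof. exact: lt_trans. Qed.

Lemma word_ltxx w : word_lt w w = false.
Proof. exact: ltxx. Qed.

Lemma word_lt_total v w : v != w -> word_lt v w || word_lt w v.
Proof.
by move=> vw; rewrite /word_lt -neq_lt; apply: contraNN vw => /eqP/(can_inj revK)->.
Qed.

Lemma word_lt_catl u v w : word_lt u v -> word_lt u (w ++ v).
Proof.
move=> uv; have [->//|w0] := eqVneq w [::].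
exact: word_lt_trans uv (word_lt_suffix _ w0).
Qed.

Lemma word_min (A : {fset seq X}) : A != fset0 ->
  exists2 m, m \in A & forall a, a \in A -> a = m \/ word_lt m a.
Proof.
case/fset0Pn => a0; rewrite -[a0 \in A]/(a0 \in enum_fset A).
suff min_seq (s : seq (seq X)) : a0 \in s ->
    exists2 m, m \in s & forall a, a \in s -> a = m \/ word_lt m a.
  exact: min_seq.
elim: s a0 => // b s IHs a0 _.
case: s IHs => [_|b' s IHs].
  by exists b; rewrite ?mem_head // => a; rewrite inE => /eqP; left.
have [m ms mP] := IHs b' (mem_head _ _).
have [bm|] := boolP (word_lt b m).
  exists b; rewrite ?mem_head // => a; rewrite inE => /orP[/eqP|/mP].
    by left.
  by case=> [->|ma]; right=> //; apply: word_lt_trans ma.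
move=> Nbm; exists m; first by rewrite inE ms orbT.
move=> a; rewrite inE => /orP[/eqP->|/mP//].
have [|/word_lt_total] := eqVneq b m; first by left.
by rewrite (negbTE Nbm); right.
Qed.

End WordOrder.

(** * Trees described by their interior vertices, and sums over the trees above a given one *)

Section Boundary.
Variables (d : Order.disp_t) (X : finOrderType d) (c : nat).
Hypothesis cardX : #|X| = c.+1.
Implicit Types (u v w : seq X) (U V Z : {fset seq X}) (T : fftree X).

(** These sets are exactly the sets of interior vertices of finite full trees, and they determine
    the tree: see [inner_suffix_closed], [fftree_of_inner] and [fftree_inner_inj]. *)
Definition suffix_closed V :=
  forall x v, x :: v \in V -> v \in V.

(** For suffix-closed V this is the vertex set of the tree with interior V, and [boundary V] is its
    set of leaves. *)
Definition full_closure V : {fset seq X} :=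
  ([::] |` [fset x :: v | x in X, v in V])%fset.

Definition boundary V : {fset seq X} := (full_closure V `\` V)%fset.

Lemma in_inner V w :
  (w \in inner V) = (w \in V) && [forall x : X, x :: w \in V].
Proof. by rewrite !inE. Qed.

Lemma in_leaves V w :
  (w \in leaves V) = (w \in V) && [forall x : X, x :: w \notin V].
Proof. by rewrite !inE. Qed.

Lemma in_full_closure V w :
  (w \in full_closure V) = (w == [::]) || (behead w \in V) && (w != [::]).
Proof.
rewrite in_fset1U; case: w => [|x w] //=; rewrite andbT.
apply/imfset2P/idP => [[y _ [v vV [_ ->]]]//|wV].
by exists x => //; exists w.
Qed.

Lemma in_boundary V w :
  (w \in boundary V) = (w \notin V) && (nilp w || (behead w \in V)).
Proof.
by rewrite in_fsetD in_full_closure; case: w => [|x w] //=; rewrite andbT.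
Qed.

Lemma suffix_closed_cat V u w :
  suffix_closed V -> u ++ w \in V -> w \in V.
Proof. by move=> scV; elim: u => //= x u IHu /scV. Qed.

Lemma boundary_catP V w : w \notin V ->
  exists u v, w = u ++ v /\ v \in boundary V.
Proof.
elim: w => [|x w IHw] wV.
  by exists [::], [::]; rewrite in_boundary wV.
have [wV'|/IHw[u [v [-> vV]]]] := boolP (w \in V).
  by exists [::], (x :: w); rewrite in_boundary wV /= wV'.
by exists (x :: u), v.
Qed.

Lemma sub_full_closure V : suffix_closed V -> (V `<=` full_closure V)%fset.
Proof.
move=> scV; apply/fsubsetP => -[|x v] vV; rewrite in_full_closure //=.
by rewrite (scV _ _ vV).
Qed.

Lemma card_full_closure V : #|` full_closure V| = (1 + #|` V| * c.+1)%N.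
Proof.
rewrite cardfsU1; congr (_ + _)%N.
  by apply/eqP; rewrite eqb1; apply/imfset2P => -[x _ [v _]].
rewrite -cardX /= -[LHS](sum1_size [fset x :: v | x in X, v in V]%fset).
rewrite big_imfset2 /=; last by move=> [x v] [y w] _ _ /= [-> ->].
under eq_bigr => x _ do rewrite sum1_size.
by rewrite big_enum sum_nat_const mulnC.
Qed.

Lemma card_boundary V : suffix_closed V -> #|` boundary V| = (1 + #|` V| * c)%N.
Proof.
move=> scV; rewrite cardfsDS ?sub_full_closure // card_full_closure.
by rewrite mulnS addnCA addnC addnK.
Qed.

Lemma inner_suffix_closed T : suffix_closed (inner T).
Proof.
by move=> x v; rewrite {1}inE => /andP[/mem_fftree[]].
Qed.

Lemma leaves_boundary T : leaves T = boundary (inner T).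
Proof.
apply/fsetP => w; rewrite in_boundary.
case: T => V /= /and3P[nilV /forallP parent /forallP full].
have /card_gt0P[x0 _] : (0 < #|X|)%N by rewrite cardX.
have mem_full v : v \in V -> (v \in leaves V) || (v \in inner V).
  by move=> vV; have := full [` vV]%fset.
have leafNinner v : v \in leaves V -> v \notin inner V.
  rewrite !inE => /andP[_ /forallP/(_ x0) xv].
  by rewrite negb_and; apply/orP; right; apply/forallPn; exists x0.
apply/idP/andP => [wL|[wI]].
  split; first exact: leafNinner.
  have wV : w \in V by move: wL; rewrite !inE => /andP[].
  case: w wL wV => [|x w] //= _ wV; have := parent [` wV]%fset => /= /mem_full.
  case/orP => //; rewrite !inE => /andP[_ /forallP/(_ x)]; by rewrite wV.
move=> wp; have /mem_full : w \in V.
  case: w wp wI => [//|x w] /= + _.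
  by rewrite !inE => /andP[_ /forallP].
by rewrite (negbTE wI) orbF.
Qed.

Lemma fftree_inner_inj : injective (fun T => inner T).
Proof.
move=> T T' eqI; apply: val_inj; apply/fsetP => w /=.
suff vertE (S : fftree X) : (w \in (S : {fset _})) =
    (w \in inner S) || (w \in boundary (inner S)).
  by rewrite !vertE eqI.
apply/idP/orP => [wS|[]].
- have [wI|wI] := boolP (w \in inner S); [by left | right].
  by rewrite in_boundary wI; have [->//|->] := mem_fftree wS; rewrite orbT.
- by rewrite inE => /andP[].
- by rewrite -leaves_boundary inE => /andP[].
Qed.

Lemma fftree_of_inner V : suffix_closed V -> exists T, inner T = V.
Proof.
move=> scV.
have /card_gt0P[x0 _] : (0 < #|X|)%N by rewrite cardX.
have innerE : inner (full_closure V) = V.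
  apply/fsetP => w; rewrite in_inner.
  apply/andP/idP => [[_ /forallP/(_ x0)]|wV]; first by rewrite in_full_closure /= andbT.
  split; first exact: (fsubsetP (sub_full_closure scV)).
  by apply/forallP => x; rewrite in_full_closure /= wV.
have closP : is_full_subtree (full_closure V).
  apply/and3P; split; first by rewrite in_full_closure.
    apply/forallP => -[w /= wV]; move: (wV); rewrite in_full_closure.
    case: w wV => [|x w] //= _; rewrite andbT => wV.
    exact: (fsubsetP (sub_full_closure scV)).
  apply/forallP => -[w /= wV]; rewrite innerE.
  have [|wNV] := boolP (w \in V); first by rewrite orbT.
  rewrite orbF in_leaves wV; apply/forallP => x.
  by rewrite in_full_closure /= andbT.
by exists (FFTree closP).
Qed.

Definition trees_above V Z N : set (fftree X) :=
  [set T | [/\ (V `<=` inner T)%fset,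
               forall z, z \in Z -> z \notin inner T & #|` inner T| = N]].

Lemma finite_trees_above V Z N : finite_set (trees_above V Z N).
Proof. by apply: sub_finite_set (finite_fftree_card X N) => T []. Qed.

(** Some suffix of w is on the boundary of V. It is not in Z, since a vertex of T has no leaf of T
    as a proper suffix. *)
Lemma trees_above_catP V Z N T w : suffix_closed V -> (Z `<=` boundary V)%fset ->
    trees_above V Z N T -> w \in inner T \/ w \in boundary (inner T) ->
    w \notin V -> w \notin Z ->
  exists u v, w = u ++ v /\ v \in (boundary V `\` Z)%fset.
Proof.
move=> scV sZV [_ disjZ _] wT wV wZ.
have [u [v [ew vb]]] := boundary_catP wV.
exists u, v; split=> //; rewrite in_fsetD vb andbT.
apply/negP => vZ; case: u ew => [|x u] ew; first by rewrite ew vZ in wZ.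
have /negP := disjZ _ vZ; apply.
apply: (suffix_closed_cat (u := u) (@inner_suffix_closed T)).
case: wT; rewrite ew /=; first exact: inner_suffix_closed.
by rewrite in_boundary => /andP[].
Qed.

Lemma nbelow_eq0 V w :
  (forall v, v \in V -> ~~ word_lt v w) -> nbelow V w = 0%N.
Proof.
move=> VP; apply/eqP; rewrite cardfs_eq0; apply/eqP/fsetP => v.
by rewrite !inE; apply/negbTE/negP => /andP[/VP/negbTE->].
Qed.

(** Moving m into V removes one factor q from each leaf greater than m, that is, from each leaf
    outside Z; the leaves in Z have weight 1 before and after. *)
Lemma prod_leaves_split (q : int) T V Z m :
    (V `<=` inner T)%fset -> (Z `<=` boundary (inner T))%fset ->
    m \in inner T -> m \notin V ->
    (forall w, w \in boundary (inner T) -> w \in Z ->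
       nbelow (inner T `\` V)%fset w = 0%N) ->
    (forall w, w \in boundary (inner T) -> w \notin Z -> word_lt m w) ->
  \prod_(w <- leaves T) q ^+ nbelow (inner T `\` V)%fset w
  = q ^+ (#|` boundary (inner T)| - #|` Z|) *
    \prod_(w <- leaves T) q ^+ nbelow (inner T `\` (m |` V))%fset w.
Proof.
move=> sVT sZT mT mV below0 m_lt; rewrite leaves_boundary.
have -> : (inner T `\` (m |` V) = (inner T `\` V) `\ m)%fset.
  by rewrite fsetUC fsetDDl.
set W := (inner T `\` V)%fset in below0 *.
have mW : m \in W by rewrite in_fsetD mV.
clearbody W.
have step w : w \in boundary (inner T) -> q ^+ nbelow W w =
    (if w \notin Z then q else 1) * q ^+ nbelow (W `\ m)%fset w.
  move=> wb; have [wZ|wZ] /= := boolP (w \in Z).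
    rewrite mul1r below0 //; congr (_ ^+ _); apply/esym/eqP.
    rewrite -leqn0 -(below0 w wb wZ); apply: fsubset_leq_card.
    by apply/fsubsetP => v; rewrite !inE => /andP[/andP[_ ->] ->].
  rewrite -exprS; congr (_ ^+ _).
  rewrite /nbelow (cardfsD1 m) !inE mW m_lt //= add1n; congr _.+1.
  rewrite (_ : [fset v in W `\ m | word_lt v w]%fset =
               [fset v in W | word_lt v w] `\ m)%fset //.
  by apply/fsetP => v; rewrite !inE; case: (v == m).
rewrite (eq_big_seq _ step) big_split /=; congr (_ * _).
rewrite -big_mkcond /= big_const_seq iter_mulr mulr1; congr (_ ^+ _).
rewrite -cardfsDS // -size_filter; apply/perm_size/uniq_perm.
- exact/filter_uniq/fset_uniq.
- exact: fset_uniq.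
- by move=> w; rewrite mem_filter [RHS]in_fsetD.
Qed.

(* Z consists of the boundary words already declared to be leaves; the
   induction decides the status of the smallest remaining boundary word. *)
Lemma sum_trees_above (q : int) m V Z r :
    suffix_closed V -> (Z `<=` boundary V)%fset ->
    (forall z a, z \in Z -> a \in (boundary V `\` Z)%fset -> word_lt z a) ->
    #|` (boundary V `\` Z)%fset| = r ->
  \sum_(T \in trees_above V Z (#|` V| + m)%N)
     \prod_(w <- leaves T) q ^+ nbelow (inner T `\` V)%fset w
  = forest_count q c m r.
Proof.
elim: m V Z r => [|m IHm] V Z r scV sZV ltZ.
  move=> _; have [T0 T0V] := fftree_of_inner scV.
  rewrite (_ : trees_above _ _ _ = [set T0]).
    rewrite fsbig_set1 big1 // T0V => w _.
    rewrite (_ : nbelow _ _ = 0%N) //; apply/eqP; rewrite cardfs_eq0.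
    by apply/eqP/fsetP => v; rewrite !inE; case: (v \in V).
  rewrite addn0; apply/seteqP; split=> [T [sVT _ cT]|_ ->].
    apply: fftree_inner_inj; rewrite T0V; apply/esym/eqP.
    by rewrite eqEfcard sVT cT leqnn.
  split; rewrite ?T0V // => z /(fsubsetP sZV).
  by rewrite in_boundary => /andP[].
(* If r = 0, all boundary words are declared leaves and no tree has further interior vertices; the
   sum is empty. *)
elim: r Z sZV ltZ => [|r IHr] Z sZV ltZ cardA.
  rewrite (_ : trees_above _ _ _ = set0) ?fsbig_set0 //.
  apply/seteqP; split=> // T TA; have [sVT disjZ cT] := TA.
  have [w wT] : exists w, w \in (inner T `\` V)%fset.
    apply/fset0Pn; rewrite -cardfs_gt0 cardfsDS // cT addnS.
    by rewrite subn_gt0 ltnS leq_addr.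
  move: wT; rewrite in_fsetD => /andP[wV wT].
  have wZ : w \notin Z by apply: contraTN wT; exact: disjZ.
  have [u [v [_]]] := trees_above_catP scV sZV TA (or_introl wT) wV wZ.
  by rewrite (cardfs0_eq cardA) inE.
have [l lA lmin] : exists2 l, l \in (boundary V `\` Z)%fset &
    forall a, a \in (boundary V `\` Z)%fset -> a = l \/ word_lt l a.
  by apply: word_min; rewrite -cardfs_gt0 cardA.
have /andP[lZ lb] : (l \notin Z) && (l \in boundary V) by rewrite -in_fsetD.
have /andP[lV lp] : (l \notin V) && (nilp l || (behead l \in V)).
  by rewrite -in_boundary.
rewrite (fsbigID [set T : fftree X | l \notin inner T]); last exact: finite_trees_above.
rewrite forest_countS; congr (_ + _).
  rewrite -(IHr (l |` Z)%fset); first last.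
  - by move: cardA; rewrite (cardfsD1 l) lA fsetUC -fsetDDl add1n => -[].
  - move=> z a; rewrite in_fset1U in_fsetD in_fset1U negb_or -andbA.
    move=> zlZ /and3P[al aZ ab]; have aA : a \in (boundary V `\` Z)%fset.
      by rewrite in_fsetD aZ.
    case/orP: zlZ => [/eqP->|zZ]; last exact: ltZ.
    by have [/eqP|//] := lmin _ aA; rewrite (negbTE al).
  - by rewrite fsubUset sZV fsub1set lb.
  apply: eq_fsbigl; apply/seteqP; split=> T /=.
    case=> -[sVT disjZ cT] lT; split=> // z; rewrite in_fset1U.
    by case/orP => [/eqP->|/disjZ].
  case=> sVT disjZ cT; split; first split=> // z zZ.
    by apply: disjZ; rewrite in_fset1U zZ orbT.
  by apply: disjZ; rewrite in_fset1U eqxx.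
(* Now l is interior and joins V; its children replace it among the undecided boundary words and
   remain larger than all of Z. *)
have scV' : suffix_closed (l |` V)%fset.
  move=> x v; rewrite !in_fset1U => /orP[/eqP xvl|/scV->]; last exact: orbT.
  by move: lp; rewrite -xvl /= => ->; rewrite orbT.
have sZV' : (Z `<=` boundary (l |` V))%fset.
  apply/fsubsetP => z zZ; rewrite in_boundary in_fset1U negb_or.
  have : z \in boundary V by exact: (fsubsetP sZV).
  rewrite in_boundary => /andP[-> zp].
  have -> : z != l by apply: contraNneq lZ => <-.
  by case/orP: zp => zp; rewrite ?in_fset1U zp ?orbT.
have r_card : (r.+1 = 1 + #|` V| * c - #|` Z|)%N.
  by rewrite -cardA cardfsDS // (card_boundary scV).
have Z_card : (#|` Z| <= 1 + #|` V| * c)%N.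
  by rewrite -(card_boundary scV) fsubset_leq_card.
have V_card : #|` (l |` V)%fset| = (#|` V|).+1 by rewrite cardfsU1 lV.
rewrite -(IHm (l |` V)%fset Z _ scV' sZV'); first last.
- by rewrite cardfsDS // card_boundary // V_card; lia.
- move=> z a zZ; rewrite in_fsetD in_boundary in_fset1U negb_or => /andP[aZ].
  case/andP => /andP[al aV] /orP[|].
    by move=> an; apply: ltZ => //; rewrite in_fsetD aZ in_boundary aV an.
  rewrite in_fset1U => /orP[/eqP al'|aV'].
    case: a al al' {aZ aV} => [|x a] /= al al'; first by rewrite -al' in al.
    by rewrite al' -cat1s; apply: word_lt_catl; exact: ltZ.
  by apply: ltZ => //; rewrite in_fsetD aZ in_boundary aV aV' orbT.
have -> : trees_above V Z (#|` V| + m.+1) `&` ~` [set T : fftree X | l \notin inner T]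
    = trees_above (l |` V)%fset Z (#|` (l |` V)%fset| + m).
  apply/seteqP; split=> T /=.
    case=> -[sVT disjZ cT] /negP; rewrite negbK => lT; split=> //.
      by rewrite fsubUset fsub1set lT.
    by rewrite cT V_card addnS.
  case=> sVT disjZ cT; split; last first.
    by apply/negP; rewrite negbK (fsubsetP sVT) // in_fset1U eqxx.
  split=> //; last by rewrite cT V_card addnS.
  by apply: fsubset_trans sVT; exact: fsubsetUr.
rewrite mulr_fsumr; apply: eq_fsbigr => T; rewrite inE => -[sVT disjZ cT].
have lT : l \in inner T by rewrite (fsubsetP sVT) // in_fset1U eqxx.
have sVT' : (V `<=` inner T)%fset.
  by apply: fsubset_trans sVT; exact: fsubsetUr.
have TA : trees_above V Z (#|` V| + m.+1) T.
  by split=> //; rewrite cT V_card addnS.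
have sZT : (Z `<=` boundary (inner T))%fset.
  apply/fsubsetP => z zZ; rewrite in_boundary disjZ //=.
  have : z \in boundary V by exact: (fsubsetP sZV).
  rewrite in_boundary => /andP[_ /orP[->//|zV]].
  by rewrite (fsubsetP sVT') ?orbT.
(* A leaf outside Z ends in an undecided boundary word, hence exceeds the minimal one l. The new
   interior vertices also end in undecided words, hence none is below a word of Z. *)
rewrite (prod_leaves_split q sVT' sZT lT lV); first last.
- move=> w wb wZ.
  have wT : w \notin inner T by move: wb; rewrite in_boundary => /andP[].
  have wV : w \notin V by apply: contraNN wT; exact: (fsubsetP sVT').
  have [u [v [ew vA]]] := trees_above_catP scV sZV TA (or_intror wb) wV wZ.
  have lv : word_lt l w \/ l = w.
    have [<-|lv] := lmin _ vA; last by left; rewrite ew word_lt_catl.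
    case: u ew => [|x u] ew; [by right | left].
    by rewrite ew word_lt_suffix.
  by case: lv => // lw; rewrite -lw lT in wT.
- move=> w wb wZ; apply: nbelow_eq0 => v; rewrite in_fsetD => /andP[vV vT].
  apply/negP => vw.
  have vZ : v \notin Z by apply: contraTN vT; exact: disjZ.
  have [u [a [ev aA]]] := trees_above_catP scV sZV TA (or_introl vT) vV vZ.
  have : word_lt w v by rewrite ev word_lt_catl // ltZ.
  by move=> /(word_lt_trans vw); rewrite word_ltxx.
(* The exponent is the number of leaves of T outside Z, namely r.+1 + m.+1 * c. *)
congr (q ^+ _ * _).
by rewrite (card_boundary (@inner_suffix_closed T)) cT V_card; lia.
Qed.

End Boundary.

(** * The triangular system for the tree polynomials *)

Section TreeRecursion.
Variables (d : Order.disp_t) (X : finOrderType d) (c : nat).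
Hypothesis cardX : #|X| = c.+1.
Variable q : int.
Implicit Types T : fftree X.

Let weight T' T : int :=
  \prod_(w <- leaves T) q ^+ nbelow (inner T `\` inner T')%fset w.

Let trees n : set (fftree X) := [set T | #|` inner T| = n].

Let below T : set (fftree X) := [set T' | (inner T' `<=` inner T)%fset].

Lemma horner_fsum (I : choiceType) (A : set I) (f : I -> {poly int}) :
  finite_set A -> (\sum_(i \in A) f i).[q] = \sum_(i \in A) (f i).[q].
Proof. by move=> finA; rewrite !fsbig_finite // horner_sum. Qed.

Lemma finite_below T : finite_set (below T).
Proof.
apply: (@sub_finite_set _ _ ([set T] `|` [set T' : fftree X | tree_lt T' T])).
  move=> T' /= sT; have [/eqP eT|neT] := boolP (inner T' == inner T).
    by left; apply: (fftree_inner_inj cardX).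
  by right; rewrite /tree_lt fproperEneq neT.
by rewrite finite_setU; split; [exact: finite_set1 | exact: finite_tree_lt].
Qed.

(** The recursive formula for E_T, evaluated at q, with C_T moved to the other side; E_T itself
    becomes the term T' = T, of weight 1. *)
Lemma horner_tree_poly T :
  q ^+ #|` inner T| * \prod_(w <- leaves T) q ^+ nbelow (inner T) w =
  \sum_(T' \in below T) (tree_poly T').[q] * weight T' T.
Proof.
rewrite (fsbigD1 T) //=; [|exact: finite_below|exact: fsubset_refl].
have -> : below T `\ T = [set T' : fftree X | tree_lt T' T].
  apply/seteqP; split=> T' /=; rewrite /tree_lt fproperEneq.
    case=> sT neT; rewrite sT andbT; apply: contra_notN neT => /eqP.
    exact: (fftree_inner_inj cardX).
  by case/andP=> neT sT; split=> // eT; rewrite eT eqxx in neT.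
have horner_weight V : (\prod_(w <- leaves T) 'X^(nbelow V w)).[q] =
    \prod_(w <- leaves T) q ^+ nbelow V w.
  by rewrite horner_prod; apply: eq_bigr => w _; rewrite hornerXn.
rewrite tree_polyE hornerD hornerN hornerM horner_weight hornerXn.
rewrite /tree_corr horner_fsum; last exact: finite_tree_lt.
have -> : weight T T = 1.
  by rewrite /weight fsetDv big1 // => w _; rewrite nbelow_eq0.
rewrite mulr1.
rewrite (eq_fsbigr (fun T' => (tree_poly T').[q] * weight T' T)) ?subrK //.
by move=> T' _; rewrite hornerM horner_weight.
Qed.

(** [horner_tree_poly] is summed over all T with N interior vertices and the sums are exchanged. By
    [sum_trees_above] with Z empty, the total weight of the trees T above T' depends only on the
    number n of interior vertices of T'. *)
Lemma complexity_poly_rec N :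
  \sum_(n < N.+1) (complexity_poly X n).[q] *
      forest_count q c (N - n) (1 + n * c)
  = q ^+ N * forest_count q c N 1.
Proof.
have fintrees n : finite_set (trees n) by exact: finite_fftree_card.
have sum_above T' n : T' \in trees n -> (n <= N)%N ->
    \sum_(T \in trees N `&` [set T | below T T']) weight T' T
    = forest_count q c (N - n) (1 + n * c).
  rewrite inE /= => cT' leN.
  rewrite -(sum_trees_above cardX q (N - n) (V := inner T') (Z := fset0)) //.
  - rewrite cT' subnKC //; apply: eq_fsbigl; apply/seteqP; split=> T /=.
      by case=> cT sT; split.
    by case.
  - exact: inner_suffix_closed.
  - by rewrite fsetD0 (card_boundary cardX) ?cT' //; exact: inner_suffix_closed.
(* With V empty, the boundary is the root alone and all trees with N interior vertices are
   summed. *)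
have -> : forest_count q c N 1 =
    \sum_(T \in trees N) \prod_(w <- leaves T) q ^+ nbelow (inner T) w.
  rewrite -(sum_trees_above cardX q N (V := fset0) (Z := fset0)) //.
  - rewrite cardfs0 add0n (_ : trees_above _ _ _ = trees N).
      by apply: eq_fsbigr => T _; rewrite fsetD0.
    apply/seteqP; split=> T; first by case.
    by move=> cT; split=> //; exact: fsub0set.
  - by rewrite fsetD0 (card_boundary cardX) ?cardfs0.
rewrite mulr_fsumr.
rewrite (eq_fsbigr (fun T =>
   \sum_(n < N.+1) \sum_(T' \in trees n) if T' \in below T then
      (tree_poly T').[q] * weight T' T else 0)); last first.
  move=> T; rewrite inE /= => cT; rewrite -{1}cT horner_tree_poly.
  rewrite fsbig_finite; last exact: finite_below.
  rewrite (partition_big (fun T' => inord #|` inner T'| : 'I_N.+1) predT) //=.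
  apply: eq_bigr => n _; rewrite -fsbig_mkcondr.
  rewrite fsbig_finite; last exact: finite_setIl.
  rewrite -big_filter; apply: perm_big; apply: uniq_perm.
  - exact/filter_uniq/fset_uniq.
  - exact: fset_uniq.
  move=> T'; rewrite mem_filter !in_fset_set; [|exact: finite_setIl|exact: finite_below].
  apply/andP/idP; rewrite !inE.
    case=> /eqP <- sT; split=> //=; rewrite inordK // ltnS -cT.
    exact: fsubset_leq_card.
  by case=> /= cT' sT; split=> //; apply/eqP/val_inj; rewrite /= inordK cT'.
rewrite [RHS]fsbig_finite // exchange_big; apply: eq_bigr => n _.
rewrite /complexity_poly horner_fsum; last exact: fintrees.
rewrite -fsbig_finite // exchange_fsbig //.
rewrite mulr_fsuml; apply: eq_fsbigr => T' T'n.
rewrite -(sum_above T' n T'n (ltnSE (ltn_ord n))) mulr_fsumr fsbig_mkcondr.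
apply: eq_fsbigr => T _.
by rewrite (_ : (T \in _) = (T' \in below T)) //; apply/idP/idP; rewrite !inE.
Qed.

End TreeRecursion.

(** * Comparison of the two triangular systems *)

(** The system is triangular with diagonal entries Q(0, r) = 1. *)
Lemma forest_sums_inj (q : int) c (a e : nat -> int) :
    (forall N, \sum_(n < N.+1) a n * forest_count q c (N - n) (1 + n * c) =
               \sum_(n < N.+1) e n * forest_count q c (N - n) (1 + n * c)) ->
  a =1 e.
Proof.
move=> ae; elim/ltn_ind => N IHN.
have := ae N; rewrite !big_ord_recr /= subnn !mulr1.
rewrite (eq_bigr (fun n : 'I_N => e n * forest_count q c (N - n) (1 + n * c))).
  by move/addrI.
by move=> n _; rewrite IHN.
Qed.

Lemma fps_tX n w : (fps_t ^+ n) w = (size w == n)%:R.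
Proof.
elim: n w => [|n IHn] w; first by rewrite expr0; case: w.
rewrite exprS; case: w => [|[] w]; first by rewrite ncmulr_nil mul0r.
rewrite (@ncmul_letter _ _ _ _ 1) ?mul1r ?IHn ?eqSS // => v.
by rewrite /fps_t /ncvar eqseq_cons /=; case: v.
Qed.

Theorem corollary6p8 (d : Order.disp_t) (X : finOrderType d) (F : finFieldType)
    (X_gt0 : (0 < #|X|)%N) :
  (forall n : nat,
     let S := [set A : ncseries X F |
                rational_series A /\ has_dim (rclosure A) n] in
     finite_set S /\ #|` fset_set S|%fset%:Z = (complexity_poly X n).[#|F|%:Z])
  /\
  [/\ ncsummable (@rational_series X F)
        (fun A => fps_t ^+ ldim (rclosure A)),
      ncsummable setT
        (fun n : nat => (complexity_poly X n).[#|F|%:Z] *: fps_t ^+ n) &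
      ncsum (@rational_series X F) (fun A => fps_t ^+ ldim (rclosure A))
      = ncsum setT
          (fun n : nat => (complexity_poly X n).[#|F|%:Z] *: fps_t ^+ n)].
Proof.
have cardX : #|X| = (#|X|.-1).+1 by rewrite prednK.
pose S n := [set A : ncseries X F | rational_series A /\ has_dim (rclosure A) n].
have SE n : S n = @of_complexity X F n.
  apply/seteqP; split=> A; first by case.
  by move=> An; split=> //; exact: has_dim_rational An.
have finS n : finite_set (S n) by rewrite SE; exact: finite_of_complexity.
have cardS n : #|` fset_set (S n)|%fset%:Z = (complexity_poly X n).[#|F|%:Z].
  (* The numbers of series and the values of the polynomials solve the same system with the same
     right side. *)
  rewrite SE; move: n; apply: (@forest_sums_inj #|F|%:Z #|X|.-1) => N.
  by rewrite (sum_of_complexity F cardX) (complexity_poly_rec cardX).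
have termE (A : ncseries X F) w : (fps_t ^+ ldim (rclosure A)) w =
    (size w == ldim (rclosure A))%:R by exact: fps_tX.
(* A word in the single letter t is determined by its length, so only the series of complexity
   [size w] contribute at w. The default value of [ldim] never occurs, rational series having
   finite-dimensional closure. *)
have supp w : [set A | @rational_series X F A /\ (fps_t ^+ ldim (rclosure A)) w != 0]
    = S (size w).
  apply/seteqP; split=> A /=; rewrite termE.
    case=> rA; have [n An] := finite_rank_dim (rational_finite_rank rA).
    by rewrite (ldim_eq An); have [->|_] := eqVneq (size w) n; rewrite ?eqxx.
  by case=> rA An; rewrite (ldim_eq An) eqxx.
have coefE w n : ((complexity_poly X n).[#|F|%:Z] *: fps_t ^+ n) w =
    (complexity_poly X n).[#|F|%:Z] * (size w == n)%:R.
  by rewrite ncscaleE fps_tX.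
split; first by move=> n; split; [exact: finS | exact: cardS].
split.
- by move=> w; rewrite supp; exact: finS.
- move=> w; apply: (@sub_finite_set _ _ [set size w]); last exact: finite_set1.
  move=> n [_]; rewrite coefE; have [->|_] := eqVneq (size w) n => //.
  by rewrite mulr0 eqxx.
apply/funext => w; rewrite /ncsum.
rewrite [RHS](_ : _ = (complexity_poly X (size w)).[#|F|%:Z]); last first.
  rewrite -(@fsbig_widen _ _ _ _ [set size w]) ?fsbig_set1 //.
    by rewrite coefE eqxx mulr1.
  move=> n [_ /= /eqP wn]; rewrite coefE.
  have [ws|_] := eqVneq (size w) n; last by rewrite mulr0.
  by case/eqP: wn.
have suppE : @rational_series X F `&`
    (fun A => (fps_t ^+ ldim (rclosure A)) w) @^-1` [set~ 0] = S (size w).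
  by rewrite -supp; apply/seteqP; split=> A [rA /= /eqP wA]; split=> //; apply/eqP.
rewrite -cardS fsbig_supp suppE.
rewrite fsbig_finite; last exact: finS.
rewrite (eq_big_seq (fun=> 1)) => [|A]; last first.
  rewrite in_fset_set ?inE; last exact: finS.
  by case=> _ An; rewrite termE (ldim_eq An) eqxx.
by rewrite big_const_seq count_predT iter_addr_0 natz.
Qed.
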